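(* Let $(T_1, T_2)$ be a pair of commuting contractions on a complex Hilbert space $\mathcal{H}$. Let $T_1$ be pure and $\dim \mathcal{D}_{T_j} < \infty$ for $j = 1, 2$. Then there exists a variety $V \subseteq \overline{\mathbb{D}^2}$ such that \[ \|p(T_1, T_2)\|_{\mathcal{B}(\mathcal{H})} \le \|p\|_V \quad \text{for all } p \in \mathbb{C}[z_1, z_2]. \] If, in addition, $T_2$ is pure, then $V$ can be taken to be a distinguished variety.
   Context: A contraction is a bounded operator $T$ with $\|T\| \le 1$. A contraction $T$ on $\mathcal{H}$ is pure if $\lim_{m\to\infty} \|T^{*m} h\| = 0$ for all $h \in \mathcal{H}$. The defect space of a contraction $T$ on $\mathcal{H}$ is $\mathcal{D}_T = \overline{\operatorname{ran}}(I_{\mathcal{H}} - T T^* )$. $\mathbb{D}$ is the open unit disc in $\mathbb{C}$, $\mathbb{D}^2 = \mathbb{D}\times\mathbb{D}$, and $\overline{\mathbb{D}^2}$ is the closed bidisc. For a set $V$, $\|p\|_V$ denotes the supremum of $|p(z_1,z_2)|$ over $(z_1,z_2)\in V$. A variety $V \subseteq \overline{\mathbb{D}^2}$ means the zero set in $\overline{\mathbb{D}^2}$ of a nonzero polynomial $q \in \mathbb{C}[z_1,z_2]$. A non-empty set $V \subseteq \mathbb{C}^2$ is a distinguished variety if there is a polynomial $q \in \mathbb{C}[z_1, z_2]$ such that $V = \{(z_1, z_2) \in \mathbb{D}^2 : q(z_1, z_2) = 0\}$ and $V$ exits the bidisc through the distinguished boundary, i.e. $\overline{V} \cap \partial \mathbb{D}^2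 = \overline{V} \cap (\partial \mathbb{D} \times \partial \mathbb{D})$, where $\partial\mathbb{D}^2$ is the topological boundary of the bidisc and $\overline{V}$ is the closure of $V$ in $\overline{\mathbb{D}^2}$. (In particular a distinguished variety is a subset of the open bidisc.) *)

(* Defs.v *)
(* The complex field is [R[i]] for [R : realType]; it carries its usual topology
   under the alias [R[i]^o].  Norms on [R[i]]-normed modules take values in
   [R[i]] (they are nonnegative there), and [complex.Re] brings them back to
   [R]. *)
From HB Require Import structures.
From mathcomp Require Import all_boot all_order all_algebra.
From mathcomp Require Import sesquilinear polyXY.
From mathcomp Require Import complex.
From mathcomp Require Import boolp classical_sets functions reals.
From mathcomp Require Import topology normedtype sequences.

Set Implicit Arguments.
Unset Strict Implicit.
Unset Printing Implicit Defensive.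

Import Order.TTheory GRing.Theory Num.Theory.
Import numFieldNormedType.Exports.

Local Open Scope classical_set_scope.
Local Open Scope ring_scope.

(* [dot] is linear in its first argument and induces the (complete) norm
   of [H]; together they make [H] a complex Hilbert space. *)
Definition hilbert_dot (R : realType) (H : completeNormedModType R[i])
    (dot : {dot H for (@Num.conj R[i])}) : Prop :=
  forall x : H, `|x| ^+ 2 = dot x x.

Definition bounded_op (R : realType) (H : completeNormedModType R[i])
    (T : H -> H) : Prop :=
  exists M : R[i], forall x : H, `|T x| <= M * `|x|.

(* Only meaningful for bounded [T]: [sup] of an unbounded set is 0. *)
Definition opnorm (R : realType) (H : completeNormedModType R[i])
    (T : H -> H) : R :=
  sup [set complex.Re `|T x| | x in [set x : H | `|x| <= 1]].

Definition contraction_op (R : realType) (H : completeNormedModType R[i])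
    (T : {linear H -> H}) : Prop :=
  bounded_op T /\ opnorm T <= 1.

(* [adjoint dot T y] is the [z] such that <T x, y> = <x, z> for all [x]; it is
   unique, and exists for bounded [T] by the Riesz representation theorem. *)
Definition adjoint (R : realType) (H : completeNormedModType R[i])
    (dot : {dot H for (@Num.conj R[i])}) (T : H -> H) (y : H) : H :=
  xget 0 [set z : H | forall x : H, dot (T x) y = dot x z].

Definition is_pure (R : realType) (H : completeNormedModType R[i])
    (dot : {dot H for (@Num.conj R[i])}) (T : H -> H) : Prop :=
  forall h : H, `|iter m (adjoint dot T) h| @[m --> \oo] --> (0 : R[i]^o).

Definition defect_space (R : realType) (H : completeNormedModType R[i])
    (dot : {dot H for (@Num.conj R[i])}) (T : H -> H) : set H :=
  closure (range (fun h : H => h - T (adjoint dot T h))).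

Definition finite_dimensional (K : fieldType) (E : lmodType K) (D : set E) :
    Prop :=
  exists (n : nat) (e : 'I_n -> E),
    D = [set \sum_(i < n) c i *: e i | c in [set: 'I_n -> K]].

(* Elements of C[z1, z2] are represented in [{poly {poly C}}], with evaluation
   [p.[z1, z2]] from [polyXY]: the outer variable is z1, the inner one z2, so
   that [p`_i`_j] is the coefficient of z1^i z2^j. *)
Definition poly_op (R : realType) (H : completeNormedModType R[i])
    (p : {poly {poly R[i]}}) (T1 T2 : H -> H) (h : H) : H :=
  \sum_(i < size p) \sum_(j < size p`_i)
    p`_i`_j *: iter i T1 (iter j T2 h).

(* Used for [V] inside the closed bidisc, where [|p|] is bounded; [sup] of the
   empty set is 0. *)
Definition norm_on (R : realType) (p : {poly {poly R[i]}})
    (V : set (R[i]^o * R[i]^o)) : R :=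
  sup [set complex.Re `|p.[z.1, z.2]| | z in V].

Definition disc (R : realType) : set R[i]^o := [set z | `|z| < 1].
Definition closed_disc (R : realType) : set R[i]^o := [set z | `|z| <= 1].

Definition bidisc (R : realType) : set (R[i]^o * R[i]^o) := @disc R `*` @disc R.
Definition closed_bidisc (R : realType) : set (R[i]^o * R[i]^o) :=
  @closed_disc R `*` @closed_disc R.

Definition boundary (X : topologicalType) (A : set X) : set X :=
  closure A `\` interior A.

Definition variety (R : realType) (V : set (R[i]^o * R[i]^o)) : Prop :=
  exists q : {poly {poly R[i]}},
    q != 0 /\ V = [set z | closed_bidisc z /\ q.[z.1, z.2] = 0].

(* The closure is taken in C^2; as the closed bidisc is closed, it agrees with
   the closure in the closed bidisc. *)
Definition distinguished_variety (R : realType) (V : set (R[i]^o * R[i]^o)) :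
    Prop :=
  [/\ V !=set0,
      exists q : {poly {poly R[i]}},
        V = [set z | bidisc z /\ q.[z.1, z.2] = 0]
    & closure V `&` boundary (@bidisc R) =
      closure V `&` (boundary (@disc R) `*` boundary (@disc R))].

(* Main.v *)
Require Import Defs.
From mathcomp Require Import all_boot all_order all_algebra.
From mathcomp Require Import sesquilinear spectral polyXY complex.
From mathcomp Require Import cyclic separable cyclotomic.
From mathcomp Require Import boolp classical_sets functions reals.
From mathcomp Require Import topology normedtype.
From mathcomp Require Import ring.

(** Write S_j for the adjoint of T_j.  Each I - T_j S_j is positive of finite
    rank, so it is a finite sum of operators x |-> <x, g> g.  As T_1 and T_2
    commute,
      (I - T_1 S_1) + T_1 (I - T_2 S_2) S_1
        = I - T_1 T_2 S_2 S_1 = (I - T_2 S_2) + T_2 (I - T_1 S_1) S_2,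
    and two finite families with the same sum of rank one operators differ by a
    unitary matrix U ([unitary_freedom]).  The coordinates of U split into those
    that come from T_1 (projection E1) and those that come from T_2 (projection
    E2); this is a colligation.  Its transfer function
      F(z) = E1 U (1 - z E2 U)^-1 E1,
    acting on rows from the right, is unitary on the range of E1 when |z| = 1
    ([transfer_isometry]).  An eigenvalue lambda of F(z) is a zero of
      det ((E1 + z E2) U - (lambda E1 + E2)),
    and this polynomial in (z, lambda) defines the variety.

    Why the inequality holds.  A row c of polynomials defines the vector
    [synth c], the sum of the T_1^n applied to the combinations of the g_i given
    by the coefficients of degree n; this map is a contraction for the l2 norm of
    the coefficients.  It carries multiplication by X to T_1 and multiplication
    by F to T_2 ([synth_step]).  On the unit circle p(z, F(z)) is a function of a
    unitary matrix, so its norm is at most the supremum of |p| over the variety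
    ([transfer_bound]); Parseval then bounds p(T_1, T_2) on the vectors [synth c].
    Purity of T_1 makes these vectors, with the right norm, dense
    ([synth_approx]).  To stay with polynomials, c is first taken to be a multiple
    of a high power of the denominator of F, and Parseval is applied on roots of
    unity.  The roots r of the denominator lie outside the closed disc, so that
    1 - (X / r)^n is a multiple of X - r which tends to 1; this removes the
    denominator one factor at a time ([bounded_multiples_factor]).

    A unimodular eigenvector of U supported in E2 decouples, and a coordinate can
    be dropped ([colligation_reduce]); in a colligation of least size there is
    none, which makes 1 - z E2 U invertible on the closed disc.  If T_2 is pure
    then the same holds in E1.  A null row x at (z, lambda) satisfies
      (1 - |lambda|^2) |x E1|^2 = (1 - |z|^2) |x E2|^2
    ([pencil_det_norm]), and in the absence of unimodular eigenvectors this forces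
    |lambda| < 1 when |z| < 1, and |lambda| = 1 when |z| = 1 and |lambda| <= 1:
    the zero set in the open bidisc is distinguished.  Passing from the torus to
    the open bidisc costs nothing, since a zero on the torus is a limit of
    zeros inside ([pencil_det_approx]). *)

Set Implicit Arguments.
Unset Strict Implicit.
Unset Printing Implicit Defensive.
Import Order.TTheory GRing.Theory Num.Theory.
Import numFieldNormedType.Exports.
Local Open Scope classical_set_scope.
Local Open Scope ring_scope.
Local Open Scope sesquilinear_scope.

Local Notation "''[' u , v ]" := (dotmx u v) : ring_scope.
Local Notation "''[' u ]" := '[u, u]%R : ring_scope.

(** * Rows under the standard inner product, and unitary matrices *)
Section Polarization.
Variables (C : numClosedFieldType) (E : lmodType C).

(** Polarization: applying the hypothesis to [a *: x + y] with [a] = 1 and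
    [a] = 'i separates [h x y] from [h y x]. *)
Lemma sesquilinear_eq0 (h : E -> E -> C) :
    (forall a x y z, h (a *: x + y) z = a * h x z + h y z) ->
    (forall a x y z, h z (a *: x + y) = a^* * h z x + h z y) ->
    (forall x, h x x = 0) ->
  forall x y, h x y = 0.
Proof.
move=> hl hr h0 x y.
have sym a : a * h x y + a^* * h y x = 0.
  by have := h0 (a *: x + y); rewrite hl !hr !h0 mulr0 add0r addr0.
have := sym 1; rewrite rmorph1 !mul1r => /eqP; rewrite addrC addr_eq0 => /eqP e.
have := sym 'i; rewrite conjCi e mulrNN -mulr2n -mulrnAl => /eqP.
by rewrite mulf_eq0 mulrn_eq0 /= (negbTE (neq0Ci _)) => /eqP.
Qed.

End Polarization.

Section RowGeometry.
Variables (C : numClosedFieldType) (m : nat).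
Implicit Types (u v w : 'rV[C]_m) (A B U : 'M[C]_m).

Lemma dotmx_sum u v : '[u, v] = \sum_i u 0 i * (v 0 i)^*.
Proof. by rewrite dotmxE mxE; apply: eq_bigr => i _; rewrite !mxE. Qed.

Lemma dotmxx_sum u : '[u] = \sum_i `|u 0 i| ^+ 2.
Proof. by rewrite dotmx_sum; apply: eq_bigr => i _; rewrite normCK. Qed.

Lemma dotmxC u v : '[u, v] = '[v, u]^*.
Proof. by rewrite (hermC (@dotmx C m)) mul1r. Qed.

Lemma dotmxZ a u : '[a *: u] = `|a| ^+ 2 * '[u].
Proof. exact: dnormZ. Qed.

Lemma dotmx_mull u v A : '[u *m A, v] = '[u, v *m A^t*].
Proof. by rewrite !dotmxE trmx_mul map_mxM trmxCK mulmxA. Qed.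

Lemma dotmx_mulr u v A : '[u, v *m A] = '[u *m A^t*, v].
Proof. by rewrite dotmx_mull trmxCK. Qed.

Lemma dotmx_delta_r u i : '[u, 'e_i] = u 0 i.
Proof.
rewrite dotmx_sum (bigD1 i) //= big1 ?mxE ?eqxx ?rmorph1 ?mulr1 ?addr0 //.
by move=> j ne; rewrite mxE (negbTE ne) andbF rmorph0 mulr0.
Qed.

Lemma mulmxV_unitary U : U \is unitarymx -> U *m U^t* = 1%:M.
Proof. by move/unitarymxP. Qed.

Lemma mulVmx_unitary U : U \is unitarymx -> U^t* *m U = 1%:M.
Proof. by move/unitarymxP/mulmx1C. Qed.

Lemma dotmx_unitary U u v : U \is unitarymx -> '[u *m U, v *m U] = '[u, v].
Proof. by move=> Uu; rewrite dotmx_mull -mulmxA mulmxV_unitary // mulmx1. Qed.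

Lemma dotmx_unitaryV U u v :
  U \is unitarymx -> '[u *m U^t*, v *m U^t*] = '[u, v].
Proof. by move=> Uu; rewrite dotmx_unitary // trmxC_unitary. Qed.

(** Only the lengths are compared in the hypothesis; polarization recovers
    the Gram matrix of the rows. *)
Lemma isometry_unitary A : (forall u, '[u *m A] = '[u]) -> A \is unitarymx.
Proof.
move=> isoA; apply/unitarymxP/row_matrixP => i; apply/rowP => j.
have e0 : forall x y, '[x *m A, y *m A] - '[x, y] = 0.
  apply: sesquilinear_eq0 => [a x y z|a x y z|x].
  - by rewrite mulmxDl -scalemxAl !linearDl !linearZl_LR /= mulrBr opprD addrACA.
  - by rewrite mulmxDl -scalemxAl !linearDr !linearZr_LR /= mulrBr opprD addrACA.
  - by rewrite isoA subrr.
have := e0 'e_i 'e_j => /subr0_eq; rewrite [LHS]dotmx_mulr !dotmx_delta_r.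
by rewrite -mulmxA -rowE row1 => ->.
Qed.

Lemma unitary_parseval U u : U \is unitarymx -> '[u] = \sum_i `|'[u, row i U]| ^+ 2.
Proof.
move=> Uu; rewrite -(dotmx_unitaryV u u Uu) dotmxx_sum; apply: eq_bigr => i _.
by congr (`| _ | ^+ 2); rewrite -dotmx_delta_r rowE dotmx_mulr.
Qed.

(** The map x |-> x - tau <x, w> w with w = u - v moves [u] to [v] as soon
    as tau <u, w> = 1.  It is isometric because 2 Re <u, w> = <w, w> when [u] and
    [v] have the same length.  The explicit shape matters: the matrix
    acts as the identity on the coordinates where both [u] and [v] vanish. *)
Lemma exists_unitary_moving u v : '[u] = '[v] ->
  exists tau : C,
    let w := u - v in let P := 1%:M - tau *: (w^t* *m w) in
    P \is unitarymx /\ u *m P = v.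
Proof.
move=> uv.
have mulP w tau x : x *m (1%:M - tau *: (w^t* *m w)) = x - (tau * '[x, w]) *: w.
  rewrite mulmxBr mulmx1 -scalemxAr mulmxA; congr (_ - _).
  by rewrite [x *m _]mx11_scalar mul_scalar_mx scalerA dotmxE.
have [w0|w_neq0] := eqVneq (u - v) 0.
  exists 0; rewrite /= scale0r subr0 mulmx1; split; last exact: subr0_eq.
  by apply/isometry_unitary => x; rewrite mulmx1.
set w := u - v; have nw : '[w] != 0 by rewrite dnorm_eq0.
have re_uw : '[u, w] + '[u, w]^* = '[w].
  rewrite /w linearBr linearBl linearBr linearBr rmorphB /= -!dotmxC uv.
  by rewrite opprB.
have uw : '[u, w] != 0.
  by apply: contraNneq nw => e; rewrite -re_uw e rmorph0 addr0.
exists ('[u, w]^-1) => /=; rewrite -/w; split; last first.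
  by rewrite mulP mulVf // scale1r subKr.
apply/isometry_unitary => x; rewrite mulP dnormB dnormZ linearZr_LR /=.
set t := '[u, w]; set a := '[x, w].
have tV : (t^-1)^* = (t^*)^-1 := fmorphV _ _.
rewrite normCK !rmorphM /= -re_uw -/t !tV ?conjCK.
have -> : (t^*)^-1^* = t^-1 by rewrite -tV conjCK.
have tc : t^* != 0 by rewrite conjC_eq0.
by field; rewrite tc uw.
Qed.

Lemma unitary_eigenvalue U v lambda : U \is unitarymx -> v != 0 ->
  v *m U = lambda *: v -> `|lambda| = 1.
Proof.
move=> Uu v0 vl; have /eqP := dotmx_unitary v v Uu; rewrite vl dotmxZ.
rewrite -[X in _ == X]mul1r (inj_eq (mulIf _)) ?dnorm_eq0 //.
by rewrite sqrp_eq1 // => /eqP.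
Qed.

Lemma unitary_eigenbasis U : U \is unitarymx ->
  exists2 P, P \is unitarymx &
    exists D : 'I_m -> C, forall k, row k P *m U = D k *: row k P.
Proof.
move=> Uu; have Un : U \is normalmx.
  by apply/normalmxP; rewrite (mulmxV_unitary Uu) (mulVmx_unitary Uu).
have /orthomx_spectralP UE := Un.
exists (spectralmx U); first exact: spectral_unitarymx.
exists (spectral_diag U 0) => k; rewrite -row_mul.
rewrite {2}UE !mulmxA mulmxV ?spectral_unit // mul1mx.
by apply/rowP => j; rewrite mul_diag_mx !mxE.
Qed.

(** A unitary matrix and its adjoint have the same eigenvectors, with
    conjugate eigenvalues. *)
Lemma dotmx_eigenvector U u v lambda : U \is unitarymx -> v != 0 ->
  v *m U = lambda *: v -> '[u *m U, v] = lambda * '[u, v].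
Proof.
move=> Uu v0 vl; have l1 := unitary_eigenvalue Uu v0 vl.
have ll : lambda * lambda^* = 1 by rewrite -normCK l1 expr1n.
by rewrite -(dotmx_unitary u v Uu) vl linearZr_LR /= mulrA ll mul1r.
Qed.

End RowGeometry.

(** * Coordinate projections, the transfer function and its determinant *)
Section CoordinateProjection.
Variables (R : nzRingType) (m : nat).
Implicit Types (s : pred 'I_m).

Definition proj s : 'M[R]_m := \matrix_(i, j) ((i == j) && s i)%:R.

Lemma mulmx_projE n (A : 'M[R]_(n, m)) s i j :
  (A *m proj s) i j = if s j then A i j else 0.
Proof.
rewrite mxE (bigD1 j) //= mxE eqxx /= big1 => [|k /negbTE ne]; last first.
  by rewrite mxE ne mulr0.
by rewrite addr0; case: (s j); rewrite ?mulr1 ?mulr0.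
Qed.

Lemma proj_idem s : proj s *m proj s = proj s.
Proof. by apply/matrixP => i j; rewrite mulmx_projE !mxE; case: eqP => [->|]; case: (s j). Qed.

Lemma projC s : proj (predC s) = 1%:M - proj s.
Proof.
apply/matrixP => i j; rewrite !mxE; case: eqP => //= _; last by rewrite subr0.
by case: (s i); rewrite ?subrr ?subr0.
Qed.

Lemma proj_projC s : proj s *m proj (predC s) = 0.
Proof. by rewrite projC mulmxBr mulmx1 proj_idem subrr. Qed.

Lemma projC_proj s : proj (predC s) *m proj s = 0.
Proof. by rewrite projC mulmxBl mul1mx proj_idem subrr. Qed.

Lemma projDC s : proj s + proj (predC s) = 1%:M.
Proof. by rewrite projC addrC subrK. Qed.

Lemma mulmx_projDC n (A : 'M[R]_(n, m)) s : A = A *m proj s + A *m proj (predC s).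
Proof. by rewrite -mulmxDr projDC mulmx1. Qed.

Lemma mulmx_projC0 n (A : 'M[R]_(n, m)) s :
  A *m proj s = A -> A *m proj (predC s) = 0.
Proof. by move=> <-; rewrite -mulmxA proj_projC mulmx0. Qed.

End CoordinateProjection.
Arguments proj {R m} s.

Lemma map_proj (R S : nzRingType) (f : {rmorphism R -> S}) m (s : pred 'I_m) :
  map_mx f (proj s) = proj s.
Proof. by apply/matrixP => i j; rewrite !mxE rmorph_nat. Qed.

Section TransferFunction.
Variables (C : numClosedFieldType) (m : nat) (s : pred 'I_m) (U : 'M[C]_m).
Hypothesis unitU : U \is unitarymx.
Implicit Types (x y v : 'rV[C]_m) (z : C).

Local Notation E1 := (proj s).
Local Notation E2 := (proj (predC s)).

Lemma proj_adj (t : pred 'I_m) : (proj t : 'M[C]_m)^t* = proj t.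
Proof.
apply/matrixP => i j; rewrite !mxE rmorph_nat eq_sym.
by case: eqP => // ->.
Qed.

Lemma dotmx_proj (t : pred 'I_m) x y : '[x *m proj t, y] = '[x, y *m proj t].
Proof. by rewrite dotmx_mull proj_adj. Qed.

Lemma dotmx_split x : '[x] = '[x *m E1] + '[x *m E2].
Proof.
rewrite -!dotmx_proj -!mulmxA !proj_idem -linearDl /=.
by rewrite -mulmx_projDC.
Qed.

Lemma dotmx_projDC a b x : '[a *: (x *m E1) + b *: (x *m E2)] =
  `|a| ^+ 2 * '[x *m E1] + `|b| ^+ 2 * '[x *m E2].
Proof.
rewrite dotmx_split !mulmxDl -!scalemxAl -!mulmxA !proj_idem proj_projC projC_proj.
by rewrite !mulmx0 !scaler0 addr0 add0r !dotmxZ.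
Qed.

(** For [t] the coordinates of one class this says that the compression of
    the unitary [A] to that class has spectrum in the open disc: an eigenvector of
    the compression with unimodular eigenvalue is an eigenvector of [A]. *)
Definition no_unimodular_eigenvector (t : pred 'I_m) (A : 'M[C]_m) :=
  forall mu v, `|mu| = 1 -> v *m proj t = v -> v *m A = mu *: v -> v = 0.

Lemma unitmx_ker (A : 'M[C]_m) :
  (forall x, x *m A = 0 -> x = 0) -> A \in unitmx.
Proof.
move=> kerA; rewrite -row_free_unit -kermx_eq0; apply/eqP/row_matrixP => i.
by rewrite row0; apply: kerA; rewrite -row_mul mulmx_ker row0.
Qed.

Section Resolvent.
Hypothesis nondegU : no_unimodular_eigenvector (predC s) U.

Definition state_mx z := 1%:M - z *: (E2 *m U).

(** A row [x] in the kernel satisfies x = z (x E2) U, and comparing lengths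
    gives |z| = 1 and x E2 = x: an eigenvector of [U] that is excluded. *)
Lemma state_mx_unit z : `|z| <= 1 -> state_mx z \in unitmx.
Proof.
move=> z1; apply: unitmx_ker => x; rewrite mulmxBr mulmx1 => /subr0_eq.
rewrite -scalemxAr mulmxA => xE.
have nx : '[x] = `|z| ^+ 2 * '[x *m E2].
  by have := congr1 (fun v => '[v]) xE; rewrite /= dotmxZ (dotmx_unitary _ _ unitU).
have [x0|x0] := eqVneq x 0; first exact: x0.
have x_gt0 : 0 < '[x] by rewrite dnorm_gt0.
have z2 : `|z| ^+ 2 <= 1 by rewrite exprn_ile1.
have le2 : '[x *m E2] <= '[x] by rewrite [leRHS]dotmx_split lerDr dnorm_ge0.
have e2 : '[x *m E2] = '[x].
  by apply/eqP; rewrite eq_le le2 /= nx ler_piMl // dnorm_ge0.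
have xE2 : x *m E2 = x.
  have /eqP := dotmx_split x; rewrite e2 -subr_eq subrr eq_sym dnorm_eq0.
  move=> /eqP x10.
  by rewrite [RHS](mulmx_projDC x s) x10 add0r.
have zn : `|z| = 1.
  apply/eqP; rewrite -(@eqrXn2 _ 2) // expr1n; apply/eqP.
  apply: (mulIf (lt0r_neq0 x_gt0)); rewrite mul1r [RHS]nx e2 //.
have z0 : z != 0 by rewrite -normr_eq0 zn oner_eq0.
apply: (nondegU (mu := z^-1) _ xE2); first by rewrite normrV ?unitfE // zn invr1.
by rewrite [in RHS]xE scalerA mulVf // scale1r xE2.
Qed.

Definition transfer z := E1 *m U *m invmx (state_mx z) *m E1.

Lemma transfer_proj z : transfer z *m E1 = transfer z.
Proof. by rewrite -mulmxA proj_idem. Qed.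

Lemma proj_transfer z : E1 *m transfer z = transfer z.
Proof. by rewrite /transfer !mulmxA proj_idem. Qed.

(** The equation on [w] is that of a linear system driven by [x]: the part
    w E1 is the output, and w E2 is the state that is fed back with a delay
    [z].  The transfer function is the map from input to output. *)
Lemma transfer_state z x w : `|z| <= 1 ->
  w = (x *m E1 + z *: (w *m E2)) *m U -> w *m E1 = x *m transfer z.
Proof.
move=> z1 wE; have Qu := state_mx_unit z1.
rewrite /transfer !mulmxA; congr (_ *m _); apply: (can_inj (mulmxK Qu)).
rewrite mulmxKV // /state_mx mulmxBr mulmx1 -scalemxAr mulmxA scalemxAl.
by apply/(canLR (addrK _)); rewrite {1}wE mulmxDl.
Qed.

Lemma transfer_state_exists z x : `|z| <= 1 ->
  exists2 w, w = (x *m E1 + z *: (w *m E2)) *m U & w *m E1 = x *m transfer z.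
Proof.
move=> z1; have Qu := state_mx_unit z1.
exists (x *m E1 *m U *m invmx (state_mx z)); last by rewrite /transfer !mulmxA.
set w := _ *m invmx _.
have : w *m state_mx z = x *m E1 *m U by rewrite mulmxKV.
rewrite /state_mx mulmxBr mulmx1 -scalemxAr mulmxA => /(canRL (subrK _)).
by rewrite mulmxDl -scalemxAl.
Qed.

(** Energy balance: [U] preserves the length of input plus state, and for
    |z| = 1 the state contributes the same amount on both sides. *)
Lemma transfer_isometry z x : `|z| = 1 -> '[x *m transfer z] = '[x *m E1].
Proof.
move=> z1; have [|w wE <-] := @transfer_state_exists z x; first by rewrite z1.
have /eqP := congr1 (fun v => '[v]) wE.
rewrite (dotmx_unitary _ _ unitU) [X in X == _]dotmx_split.
have -> : x *m E1 + z *: (w *m E2) =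
    1 *: ((x *m E1 + w *m E2) *m E1) + z *: ((x *m E1 + w *m E2) *m E2).
  rewrite !mulmxDl -!mulmxA !proj_idem proj_projC projC_proj !mulmx0.
  by rewrite addr0 add0r scale1r.
rewrite dotmx_projDC z1 normr1 !expr1n !mul1r.
rewrite !mulmxDl -!mulmxA !proj_idem proj_projC projC_proj !mulmx0.
by rewrite addr0 add0r => /eqP/addIr.
Qed.

(** Adding the identity on the range of E2 gives a unitary matrix of full
    size, to which the spectral theorem applies. *)
Lemma transfer_completion_unitary z :
  `|z| = 1 -> transfer z + E2 \is unitarymx.
Proof.
move=> z1; apply: isometry_unitary => x.
have tE : x *m transfer z *m E1 = x *m transfer z by rewrite -mulmxA transfer_proj.
have -> : x *m (transfer z + E2) =
    1 *: ((x *m transfer z + x *m E2) *m E1) +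
    1 *: ((x *m transfer z + x *m E2) *m E2).
  by rewrite !scale1r -mulmx_projDC mulmxDr.
rewrite dotmx_projDC normr1 !expr1n !mul1r [RHS]dotmx_split.
rewrite !mulmxDl tE (mulmx_projC0 tE) -!mulmxA proj_idem projC_proj mulmx0.
by rewrite addr0 add0r transfer_isometry.
Qed.

Lemma transfer_completion_proj z : (transfer z + E2) *m E1 = transfer z.
Proof. by rewrite mulmxDl transfer_proj projC_proj addr0. Qed.

Lemma proj_transfer_completion z : E1 *m (transfer z + E2) = transfer z.
Proof. by rewrite mulmxDr proj_transfer proj_projC addr0. Qed.
End Resolvent.

Definition pencil_det z1 z2 :=
  \det ((E1 + z1 *: E2) *m U - (z2 *: E1 + E2)).

(** Null rows are the solutions of the system whose output is the input
    multiplied by [z2], for the delay [z1]. *)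
Lemma pencil_detP z1 z2 : reflect
  (exists2 x : 'rV[C]_m, x != 0 & (x *m E1 + z1 *: (x *m E2)) *m U = z2 *: (x *m E1) + x *m E2)
  (pencil_det z1 z2 == 0).
Proof.
have mE (x : 'rV[C]_m) : x *m ((E1 + z1 *: E2) *m U - (z2 *: E1 + E2)) =
  (x *m E1 + z1 *: (x *m E2)) *m U - (z2 *: (x *m E1) + x *m E2).
  by rewrite mulmxBr mulmxA !mulmxDr -!scalemxAr.
apply: (iffP det0P) => -[x x0 xE]; exists x => //.
  by apply: subr0_eq; rewrite -mE.
by rewrite /= (mE x) xE subrr.
Qed.

Lemma pencil_det_norm z1 z2 x :
  (x *m E1 + z1 *: (x *m E2)) *m U = z2 *: (x *m E1) + x *m E2 ->
  (1 - `|z2| ^+ 2) * '[x *m E1] = (1 - `|z1| ^+ 2) * '[x *m E2].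
Proof.
move=> /(congr1 (fun v => '[v])); rewrite (dotmx_unitary _ _ unitU).
have := dotmx_projDC 1 z1 x; have := dotmx_projDC z2 1 x; rewrite !scale1r => -> ->.
rewrite normr1 !expr1n !mul1r !mulrBl !mul1r => e.
by apply/eqP; rewrite subr_eq addrAC -subr_eq opprK e addrC.
Qed.

Lemma pencil_det_eigen z x lambda : no_unimodular_eigenvector (predC s) U ->
  `|z| <= 1 -> x != 0 -> x *m E1 = x ->
  x *m transfer z = lambda *: x -> pencil_det z lambda = 0.
Proof.
move=> nondegU z1 x0 xE1 xl; have [w wE] := transfer_state_exists nondegU x z1.
rewrite xl => wl; apply/eqP/pencil_detP; exists (x + w *m E2).
  apply: contraNneq x0 => /(congr1 (mulmx^~ E1)).
  by rewrite mulmxDl -mulmxA projC_proj mulmx0 mul0mx addr0 xE1 => ->.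
have -> : (x + w *m E2) *m E1 = x.
  by rewrite mulmxDl -mulmxA projC_proj mulmx0 addr0.
have -> : (x + w *m E2) *m E2 = w *m E2.
  by rewrite mulmxDl -mulmxA proj_idem (mulmx_projC0 xE1) add0r.
by rewrite -wl -mulmx_projDC [RHS]wE xE1.
Qed.

End TransferFunction.

(** * The spectral bound on the unit circle *)
Section BivariateSum.
Variables (C : comNzRingType).

(** Both p(x, y) for numbers and p(T_1, T_2) h for operators have this
    shape, so that linear maps can be exchanged with either. *)
Definition bisum (V : lmodType C) (p : {poly {poly C}}) (f : nat -> nat -> V) : V :=
  \sum_(i < size p) \sum_(j < size p`_i) p`_i`_j *: f i j.

Lemma eq_bisum (V : lmodType C) (p : {poly {poly C}}) (f g : nat -> nat -> V) :
  (forall i j, (j < size (p`_i)%R)%N -> f i j = g i j) -> bisum p f = bisum p g.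
Proof.
by move=> fg; apply: eq_bigr => i _; apply: eq_bigr => j _; rewrite fg.
Qed.

Lemma linear_bisum (V W : lmodType C) (L : V -> W) p f :
    (forall a x y, L (a *: x + y) = a *: L x + L y) ->
  L (bisum p f) = bisum p (fun i j => L (f i j)).
Proof.
move=> linL.
have addL x y : L (x + y) = L x + L y by rewrite -[x]scale1r linL !scale1r.
have L0 : L 0 = 0 by apply: (addrI (L 0)); rewrite -addL !addr0.
have scaleL a x : L (a *: x) = a *: L x by rewrite -[a *: x]addr0 linL L0 addr0.
rewrite (big_morph L addL L0); apply: eq_bigr => i _.
by rewrite (big_morph L addL L0); apply: eq_bigr => j _; rewrite scaleL.
Qed.

Lemma horner2_bisum p (x y : C) :
  p.[x%:P].[y] = bisum p (fun i j => x ^+ i * y ^+ j : C^o).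
Proof.
rewrite (horner_coef p) horner_sum; apply: eq_bigr => i _.
rewrite -rmorphXn hornerM hornerC horner_coef mulr_suml.
by apply: eq_bigr => j _; rewrite -mulrA [y ^+ j * _]mulrC.
Qed.

Lemma bisum_mulr p (f : nat -> nat -> C) (a : C) :
  bisum p (fun i j => f i j * a : C^o) = (bisum p (f : nat -> nat -> C^o) : C) * a.
Proof.
rewrite mulr_suml; apply: eq_bigr => i _; rewrite mulr_suml.
by apply: eq_bigr => j _; rewrite /GRing.scale /= mulrA.
Qed.

End BivariateSum.

Section SpectralBound.
Variables (C : numClosedFieldType) (m : nat) (s : pred 'I_m).
Implicit Types (U G : 'M[C]_m) (c v : 'rV[C]_m).

(** In an orthonormal eigenbasis of [G] each coordinate is multiplied by
    a value p(z, lambda).  As [c] is in the range of the projection, it has no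
    component along an eigenvector that the projection kills; for the others, the
    projected eigenvector is an eigenvector in the range, where the bound is
    available. *)
Lemma spectral_bound G (p : {poly {poly C}}) z M c :
    G \is unitarymx -> G *m proj s = proj s *m G -> c *m proj s = c ->
    (forall lambda v, v != 0 -> v *m proj s = v -> v *m G = lambda *: v ->
      `|p.[z%:P].[lambda]| <= M) ->
  '[bisum p (fun i j => z ^+ i *: iter j (mulmx^~ G) c)] <= M ^+ 2 * '[c].
Proof.
move=> Gu Gs cs bound.
have [P Pu [D PG]] := unitary_eigenbasis Gu.
have P0 k : row k P != 0.
  rewrite -(dnorm_eq0 (@dotmx C m)); have /row_unitarymxP/(_ k k) := Pu.
  by rewrite eqxx /= => ->; rewrite oner_eq0.
have dG j k : '[iter j (mulmx^~ G) c, row k P] = D k ^+ j * '[c, row k P].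
  elim: j => [|j IH]; first by rewrite mul1r.
  by rewrite iterS (dotmx_eigenvector _ Gu (P0 k) (PG k)) IH exprS mulrA.
rewrite [leLHS](unitary_parseval _ Pu) [in leRHS](unitary_parseval c Pu) mulr_sumr.
apply: ler_sum => k _.
have -> : '[bisum p (fun i j => z ^+ i *: iter j (mulmx^~ G) c), row k P] =
    p.[z%:P].[D k] * '[c, row k P].
  rewrite (linear_bisum (W := C^o) (L := fun x => '[x, row k P])); last first.
    by move=> a x y; rewrite linearDl linearZl_LR.
  rewrite horner2_bisum -bisum_mulr.
  by apply: (@eq_bisum _ C^o) => i j _; rewrite linearZl_LR /= dG mulrA.
rewrite normrM exprMn.
have [->|nz] := eqVneq '[c, row k P] 0; first by rewrite normr0 expr0n !mulr0.
rewrite ler_wpM2r ?exprn_ge0 //.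
have pos : `|p.[z%:P].[D k]| <= M.
  apply: (bound _ (row k P *m proj s)).
  - apply: contraNneq nz => e; rewrite -cs dotmx_proj e.
    by rewrite linear0r.
  - by rewrite -mulmxA proj_idem.
  - by rewrite -mulmxA -Gs mulmxA PG scalemxAl.
by rewrite lerXn2r ?nnegrE // (le_trans _ pos).
Qed.

Lemma transfer_bound U (p : {poly {poly C}}) z M c :
    U \is unitarymx -> no_unimodular_eigenvector (predC s) U ->
    `|z| = 1 -> c *m proj s = c ->
    (forall lambda, `|lambda| = 1 -> pencil_det s U z lambda = 0 ->
      `|p.[z%:P].[lambda]| <= M) ->
  '[bisum p (fun i j => z ^+ i *: iter j (mulmx^~ (transfer s U z)) c)]
    <= M ^+ 2 * '[c].
Proof.
move=> Uu nondegU z1 cs bound; set F := transfer s U z.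
have Gu := transfer_completion_unitary Uu nondegU z1; rewrite -/F in Gu.
have z1le : `|z| <= 1 by rewrite z1.
set G := F + proj (predC s) in Gu.
have GE1 : G *m proj s = F by exact: transfer_completion_proj.
have E1G : proj s *m G = F by exact: proj_transfer_completion.
have vG v : v *m proj s = v -> v *m G = v *m F.
  by move=> vs; rewrite -{1}vs -mulmxA E1G.
have -> : bisum p (fun i j => z ^+ i *: iter j (mulmx^~ F) c) =
          bisum p (fun i j => z ^+ i *: iter j (mulmx^~ G) c).
  apply: eq_bisum => i j _; congr (_ *: _); elim: j => //= j IH.
  rewrite -IH vG //; case: j {IH} => //= j.
  by rewrite -mulmxA transfer_proj.
apply: spectral_bound => //; first by rewrite GE1 E1G.
move=> lambda v v0 vs vl.
have l1 : `|lambda| = 1 := unitary_eigenvalue Gu v0 vl.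
apply: bound => //; apply: (pencil_det_eigen Uu nondegU z1le v0 vs).
by rewrite -vG.
Qed.

End SpectralBound.

Section PencilPolynomial.
Variables (C : numClosedFieldType) (m : nat) (s : pred 'I_m) (U : 'M[C]_m).

Definition pencil_poly : {poly {poly C}} :=
  \det ((proj s + 'X *: proj (predC s)) *m map_mx (fun a => a%:P%:P) U
        - ('X%:P *: proj s + proj (predC s))).

Lemma pencil_polyE z1 z2 : pencil_poly.[z1%:P].[z2] = pencil_det s U z1 z2.
Proof.
rewrite -[LHS]/((horner_eval z2 \o horner_eval z1%:P) pencil_poly).
rewrite -det_map_mx; congr (\det _); rewrite !rmorphB /= map_mxM map_mxD.
rewrite !map_mxD !map_mxZ !map_proj; congr (_ *m _ - _).
- by congr (_ + _ *: _); rewrite /= /horner_eval hornerX hornerC.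
- by apply/matrixP => i j; rewrite !mxE /= /horner_eval !hornerC.
- by congr (_ *: _ + _); rewrite /= /horner_eval hornerC hornerX.
Qed.

(** At (0, 2) the norm identity reads -3 |x E1|^2 = |x E2|^2, which leaves no
    null row. *)
Lemma pencil_poly_neq0 : U \is unitarymx -> pencil_poly != 0.
Proof.
move=> Uu; apply/eqP => p0; have /eqP := pencil_polyE 0 2%:R.
rewrite p0 !horner0 eq_sym => /pencil_detP[x x0 xE].
have := pencil_det_norm Uu xE; rewrite normr0 expr0n subr0 mul1r => e.
have ge : 0 <= '[x *m proj (predC s)] by exact: dnorm_ge0.
have e1 : '[x *m proj s] = 0.
  apply/eqP; rewrite eq_le dnorm_ge0 andbT.
  rewrite -(@pmulr_rle0 _ 3%:R) // (natrB _ (isT : (1 <= 2 ^ 2)%N)).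
  rewrite normr_nat -natrX in e.
  have : - ((1 - (2 ^ 2)%:R) * '[x *m proj s]) <= 0 by rewrite oppr_le0 e.
  by rewrite -mulNr opprB.
move: e; rewrite e1 mulr0 => /esym e2.
have /eqP : '[x] = 0 by rewrite (dotmx_split s) e1 e2 addr0.
by rewrite dnorm_eq0 (negbTE x0).
Qed.

End PencilPolynomial.

(** * Parseval on roots of unity, and rows of polynomials *)
Section Parseval.
Variable C : numClosedFieldType.
Implicit Types (f g : {poly C}).

Lemma exists_primitive_root N : (0 < N)%N -> exists w : C, N.-primitive_root w.
Proof.
move=> n_gt0; have [r Dp] := closed_field_poly_normal ('X^N - 1 : {poly C}).
rewrite (monicP _) ?monicXnsubC // scale1r in Dp.
have rn1 : all N.-unity_root r by apply/allP => z; rewrite -root_prod_XsubC -Dp.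
have sz_r : (N < (size r).+1)%N.
  by rewrite -(size_prod_XsubC r id) -Dp size_XnsubC.
have [|z] := hasP (has_prim_root n_gt0 rn1 _ sz_r); last by exists z.
by rewrite -separable_prod_XsubC -Dp separable_Xn_sub_1 // pnatr_eq0 -lt0n.
Qed.

Definition coef_sq f := \sum_(n < size f) `|f`_n| ^+ 2.

Lemma coef_sq_widen N f : (size f <= N)%N -> coef_sq f = \sum_(n < N) `|f`_n| ^+ 2.
Proof.
move=> sN; rewrite /coef_sq (big_ord_widen N (fun n => `|f`_n| ^+ 2)) //.
rewrite big_mkcond; apply: eq_bigr => i _; case: ltnP => // le.
by rewrite nth_default // normr0 expr0n.
Qed.

Lemma norm_primitive_root N (w : C) : N.-primitive_root w -> `|w| = 1.
Proof.
move=> pw; apply/eqP; rewrite -(@pexpr_eq1 _ _ N) ?(prim_order_gt0 pw) //.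
by rewrite -normrX prim_expr_order // normr1.
Qed.

Lemma sum_root_of_unity N (x : C) : x ^+ N = 1 -> x != 1 ->
  \sum_(k < N) x ^+ k = 0.
Proof.
move=> xN x1; apply: (mulfI (x := x - 1)); first by rewrite subr_eq0.
by rewrite -subrX1 xN subrr mulr0.
Qed.

(** Powers of a primitive root sample the unit circle finely enough for a
    polynomial of degree less than [N], so that no integral is needed. *)
Lemma parseval N (w : C) f : N.-primitive_root w -> (size f <= N)%N ->
  \sum_(k < N) `|f.[w ^+ k]| ^+ 2 = N%:R * coef_sq f.
Proof.
move=> pw sf; rewrite (coef_sq_widen sf).
have w1 := norm_primitive_root pw.
have wc : w * w^* = 1 by rewrite -normCK w1 expr1n.
under eq_bigr => k _.
  rewrite normCK (horner_coef_wide _ sf) rmorph_sum mulr_suml.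
  under eq_bigr => n _ do rewrite mulr_sumr.
  over.
rewrite exchange_big mulr_sumr; apply: eq_bigr => n _ /=.
rewrite exchange_big /= (bigD1 n) //= [X in _ + X]big1 ?addr0.
  under eq_bigr => k _.
    rewrite rmorphM /= mulrACA -!normCK !normrX w1 !expr1n mulr1.
    over.
  by rewrite sumr_const card_ord mulr_natl.
move=> l ne.
under eq_bigr => k _.
  rewrite rmorphM /= mulrACA rmorphXn /= rmorphXn /= -!exprM.
  rewrite [(k * n)%N]mulnC [(k * l)%N]mulnC !exprM -exprMn.
  over.
rewrite -mulr_sumr sum_root_of_unity ?mulr0 //.
  rewrite exprMn -!exprM ![(_ * N)%N]mulnC !exprM -rmorphXn /= (prim_expr_order pw).
  by rewrite rmorph1 !expr1n mulr1.
apply: contra ne => /eqP e; rewrite -val_eqE /= eq_sym.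
rewrite -(modn_small (ltn_ord n)) -(modn_small (ltn_ord l)) -(eq_prim_root_expr pw).
rewrite -[X in _ == X]mul1r -e -mulrA -exprMn [w^* * w]mulrC wc expr1n mulr1.
done.
Qed.

Variable m : nat.
Implicit Types c : 'rV[{poly C}]_m.

Definition row_eval (z : C) c : 'rV[C]_m := map_mx (horner_eval z) c.
Definition row_sq c := \sum_i coef_sq (c 0 i).

Lemma row_parseval N (w : C) c : N.-primitive_root w ->
    (forall i, (size (c 0%R i) <= N)%N) ->
  \sum_(k < N) '[row_eval (w ^+ k) c] = N%:R * row_sq c.
Proof.
move=> pw sc; under eq_bigr => k _ do rewrite dotmxx_sum.
rewrite exchange_big mulr_sumr; apply: eq_bigr => i _ /=.
by rewrite -(parseval pw) //; apply: eq_bigr => k _; rewrite mxE.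
Qed.

(** A pointwise comparison on the unit circle passes to the l2 norms of the
    coefficients. *)
Lemma row_sq_le c d (M : C) :
    (forall z, `|z| = 1 -> '[row_eval z c] <= M * '[row_eval z d]) ->
  row_sq c <= M * row_sq d.
Proof.
move=> le_cd.
pose N := (\max_i maxn (size (c 0%R i)) (size (d 0%R i))).+1.
have [w pw] := @exists_primitive_root N isT.
have sN i : (maxn (size (c 0%R i)) (size (d 0%R i)) <= N)%N.
  by apply/leqW/(leq_bigmax i).
have N0 : 0 < N%:R :> C by rewrite ltr0n.
rewrite -(ler_pM2l N0) mulrCA -!(row_parseval pw).
- rewrite mulr_sumr; apply: ler_sum => k _; apply: le_cd.
  by rewrite normrX (norm_primitive_root pw) expr1n.
- by move=> i; apply: leq_trans (sN i); rewrite leq_maxr.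
- by move=> i; apply: leq_trans (sN i); rewrite leq_maxl.
Qed.

End Parseval.

Section PolynomialDilation.
Variables (C : numClosedFieldType) (m : nat) (s : pred 'I_m) (U : 'M[C]_m).
Hypothesis unitU : U \is unitarymx.
Hypothesis nondegU : no_unimodular_eigenvector (predC s) U.
Implicit Types c w : 'rV[{poly C}]_m.

Local Notation UP := (map_mx (@polyC C) U).
Local Notation E1 := (proj s).
Local Notation E2 := (proj (predC s)).

Definition state_mxX : 'M[{poly C}]_m := 1%:M - 'X *: (E2 *m UP).
Definition transfer_den := \det state_mxX.

Lemma map_state_mxX z : map_mx (horner_eval z) state_mxX = state_mx s U z.
Proof.
rewrite map_mxB map_mx1 map_mxZ map_mxM map_proj /= /horner_eval hornerX.
by congr (_ - _ *: (_ *m _)); apply/matrixP => i j; rewrite !mxE /= hornerC.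
Qed.

Lemma transfer_den_eval z : transfer_den.[z] = \det (state_mx s U z).
Proof. by rewrite -map_state_mxX det_map_mx. Qed.

Lemma transfer_den_neq0 z : `|z| <= 1 -> transfer_den.[z] != 0.
Proof.
by move=> z1; rewrite transfer_den_eval -unitfE -unitmxE; apply: state_mx_unit.
Qed.

(** Multiplication by the transfer function, with the denominator
    [transfer_den] cleared. *)
Definition transfer_num c := c *m E1 *m UP *m \adj state_mxX *m E1.

(** [c'] is [c] multiplied by the transfer function, in a form that involves
    polynomials only: [w] collects the output and the state. *)
Definition transfer_step c c' := exists2 w,
  w = (c *m E1 + 'X *: (w *m E2)) *m UP & w *m E1 = c'.

Lemma transfer_step_num (a : {poly C}) c :
  transfer_step ((a * transfer_den) *: c) (a *: transfer_num c).
Proof.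
pose y := c *m E1 *m UP *m \adj state_mxX; exists (a *: y); last first.
  by rewrite -scalemxAl.
have yQ : y *m state_mxX = transfer_den *: (c *m E1 *m UP).
  by rewrite /y -mulmxA mul_adj_mx mul_mx_scalar.
have yE : y = transfer_den *: (c *m E1 *m UP) + 'X *: (y *m E2 *m UP).
  rewrite -yQ /state_mxX mulmxBr mulmx1 -scalemxAr mulmxA.
  by rewrite subrK.
rewrite [in LHS]yE scalerDr mulmxDl -!scalemxAl !scalerA.
by congr (_ + _); rewrite mulrC.
Qed.

Lemma row_eval_step z c c' : `|z| <= 1 -> transfer_step c c' ->
  row_eval z c' = row_eval z c *m transfer s U z.
Proof.
move=> z1 [w wE <-]; rewrite /row_eval map_mxM map_proj.
apply: transfer_state => //; rewrite {1}wE map_mxM map_mxD map_mxZ !map_mxM.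
rewrite !map_proj /= /horner_eval hornerX; congr (_ *m _).
by apply/matrixP => i j; rewrite !mxE /= hornerC.
Qed.

Definition poly_act (p : {poly {poly C}}) (cs : nat -> 'rV[{poly C}]_m) :=
  \sum_(i < size p) \sum_(j < size p`_i) (p`_i`_j *: 'X^i) *: cs j.

Lemma row_eval_poly_act (z : C) p cs :
  row_eval z (poly_act p cs) = bisum p (fun i j => z ^+ i *: row_eval z (cs j)).
Proof.
rewrite /row_eval raddf_sum; apply: eq_bigr => i _; rewrite raddf_sum.
apply: eq_bigr => j _; rewrite /= map_mxZ /= /horner_eval hornerZ hornerXn.
by rewrite scalerA.
Qed.

(** The rows [cs j] are the successive images of [cs 0] under the transfer
    function, so that at a point of the circle the left side is p(z, F(z)) applied
    to the value of [cs 0]. *)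
Lemma row_sq_poly_act (p : {poly {poly C}}) cs (M : C) :
    (forall i j, (j < size (p`_i)%R)%N -> forall l, (l < j)%N -> transfer_step (cs l) (cs l.+1)) ->
    cs 0%N *m E1 = cs 0%N ->
    (forall z lambda, `|z| = 1 -> `|lambda| = 1 -> pencil_det s U z lambda = 0 ->
      `|p.[z%:P].[lambda]| <= M) ->
  row_sq (poly_act p cs) <= M ^+ 2 * row_sq (cs 0%N).
Proof.
move=> csS cs0 bound; apply: row_sq_le => z z1; rewrite row_eval_poly_act.
have -> : bisum p (fun i j => z ^+ i *: row_eval z (cs j)) =
  bisum p (fun i j => z ^+ i *: iter j (mulmx^~ (transfer s U z)) (row_eval z (cs 0%N))).
  apply: eq_bisum => i j ji; congr (_ *: _).
  have := csS i j ji; elim: j {ji} => //= j IH jS.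
  rewrite -IH => [|l lj]; last by apply: jS; rewrite ltnW.
  by apply: row_eval_step; rewrite ?z1 //; apply: jS.
apply: transfer_bound => //; last by move=> lambda; apply: bound.
by rewrite /row_eval -{2}cs0 map_mxM map_proj.
Qed.

End PolynomialDilation.

(** * Complex Hilbert spaces: Cauchy-Schwarz and Riesz representation *)
Section ComplexReals.
Variable R : realType.
Implicit Types (x y e : R[i]).

Lemma ge0_ReE x : 0 <= x -> x = (complex.Re x)%:C%C.
Proof. by move=> x0; rewrite RRe_real // ger0_real. Qed.

Lemma gt0_Re x : 0 < x -> 0 < complex.Re x.
Proof. by rewrite ltcE => /andP[]. Qed.

Lemma ler_Re x y : x <= y -> complex.Re x <= complex.Re y.
Proof. by rewrite lecE => /andP[]. Qed.

Lemma small_invn e : 0 < e -> exists N, forall n, (N <= n)%N -> n.+1%:R^-1 < e.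
Proof.
move=> e0; have re0 := gt0_Re e0.
have : 0 <= (complex.Re e)^-1 by rewrite invr_ge0 ltW.
move=> /archi_boundP; set N := Num.bound _ => NP; exists N => n Nn.
have n1 : (complex.Re e)^-1 < n.+1%:R.
  by apply: lt_le_trans NP _; rewrite ler_nat leqW.
rewrite (ge0_ReE (ltW e0)) -(rmorph_nat (real_complex R)) -fmorphV ltcR.
by rewrite -[ltRHS]invrK ltf_pV2 ?posrE ?invr_gt0.
Qed.

(** The order of the complex numbers is partial: that [x] is real
    has to be derived from the comparison with a real number. *)
Lemma ler_small x y (K : R[i]) : 0 <= K ->
  (forall e, 0 < e -> x <= y + K * e) -> y \is Num.real -> x <= y.
Proof.
move=> K0 h yr.
have xr : x \is Num.real.
  have := h 1 ltr01; rewrite mulr1 => hx.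
  by rewrite (ler_real hx) rpredD // ger0_real.
case: (real_leP xr yr) => // yx.
have K1 : 0 < K + 1 by rewrite ltr_wpDl.
have e0 : 0 < (x - y) / (K + 1) / 2%:R by rewrite !divr_gt0 ?subr_gt0.
have := h _ e0; rewrite -lerBlDl => hx.
have : K * ((x - y) / (K + 1) / 2%:R) < x - y.
  have d0 : 0 < x - y by rewrite subr_gt0.
  rewrite mulrA ltr_pdivrMr // mulrA ltr_pdivrMr // mulrC -mulrA ltr_pM2l //.
  rewrite mulrDr mulr1 mulr_natl mulr2n -addrA ltrDl addrC ltr_wpDr //.
by move=> /(le_lt_trans hx); rewrite ltxx.
Qed.

End ComplexReals.

Section CauchySchwarz.
Variables (C : numClosedFieldType) (E : lmodType C) (h : E -> E -> C).
Hypothesis hl : forall a x y z, h (a *: x + y) z = a * h x z + h y z.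
Hypothesis hC : forall x y, h x y = (h y x)^*.
Hypothesis h_ge0 : forall x, 0 <= h x x.

Lemma form_cauchy_schwarz x y : 0 < h y y -> `|h x y| ^+ 2 <= h x x * h y y.
Proof.
move=> y0; set a := - (h x y / h y y).
have hr b u v z : h z (b *: u + v) = b^* * h z u + h z v.
  by rewrite hC hl rmorphD rmorphM /= -!hC.
have := h_ge0 (a *: y + x); rewrite hl !hr.
have yr : (h y y)^* = h y y by rewrite -hC.
have ac : a^* = - (h y x / h y y) by rewrite rmorphN rmorphM fmorphV /= yr -hC.
rewrite ac /a normCK -hC.
have -> : - (h x y / h y y) * (- (h y x / h y y) * h y y + h y x) +
  (- (h y x / h y y) * h x y + h x x) = (h x x * h y y - h x y * h y x) / h y y.
  by field; rewrite gt_eqF.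
by rewrite pmulr_lge0 ?invr_gt0 // subr_ge0.
Qed.

End CauchySchwarz.

Section Riesz.
Variables (R : realType) (H : completeNormedModType R[i]).
Variable dot : {dot H for (@Num.conj R[i])}.
Hypothesis dotE : hilbert_dot dot.
Local Notation C := R[i].
Implicit Types x y z : H.

Lemma hdotC x y : dot x y = (dot y x)^*.
Proof. by rewrite (hermC dot) mul1r. Qed.

Lemma hdotDl x y z : dot (x + y) z = dot x z + dot y z.
Proof. exact: linearDl. Qed.
Lemma hdotDr x y z : dot z (x + y) = dot z x + dot z y.
Proof. exact: linearDr. Qed.
Lemma hdotBl x y z : dot (x - y) z = dot x z - dot y z.
Proof. exact: linearBl. Qed.
Lemma hdotBr x y z : dot z (x - y) = dot z x - dot z y.
Proof. exact: linearBr. Qed.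
Lemma hdotZl a x z : dot (a *: x) z = a * dot x z.
Proof. exact: linearZl_LR. Qed.
Lemma hdotZr a x z : dot z (a *: x) = a^* * dot z x.
Proof. exact: linearZr_LR. Qed.
Lemma hdot0r z : dot z 0 = 0.
Proof. exact: linear0r. Qed.

Lemma hdot_suml I (r : seq I) (P : pred I) (F : I -> H) z :
  dot (\sum_(i <- r | P i) F i) z = \sum_(i <- r | P i) dot (F i) z.
Proof. exact: linear_sumlz. Qed.
Lemma hdot_inj x y : (forall z, dot z x = dot z y) -> x = y.
Proof.
move=> xy; apply/eqP; rewrite -subr_eq0 -normr_eq0 -(@eqrXn2 _ 2) ?normr_ge0 //.
by rewrite dotE hdotBr xy subrr expr0n.
Qed.

Lemma hdot_cauchy_schwarz x y : `|dot x y| <= `|x| * `|y|.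
Proof.
have [->|y0] := eqVneq y 0; first by rewrite hdot0r !normr0 mulr0.
rewrite -(@ler_pXn2r _ 2) ?nnegrE ?mulr_ge0 // exprMn !dotE.
apply: form_cauchy_schwarz => [a u v z|u v|u|].
- by rewrite hdotDl hdotZl.
- exact: hdotC.
- by rewrite -dotE exprn_ge0.
- by rewrite -dotE exprn_gt0 // normr_gt0.
Qed.

(** The functional |x|^2 - 2 Re f x is bounded below and strictly convex.  The
    parallelogram identity makes a minimizing sequence Cauchy, and the first
    variation at its limit [z] says that f = <., z>. *)
Lemma riesz (f : H -> C) (K : C) : 0 <= K ->
    (forall a x y, f (a *: x + y) = a * f x + f y) ->
    (forall x, `|f x| <= K * `|x|) ->
  exists z, forall x, f x = dot x z.
Proof.
move=> K0 lf bf.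
have fD x y : f (x + y) = f x + f y by rewrite -[x]scale1r lf mul1r scale1r.
have f0 : f 0 = 0 by apply: (addrI (f 0)); rewrite -fD !addr0.
have fZ a x : f (a *: x) = a * f x by rewrite -[a *: x]addr0 lf f0 addr0.
(* The value is real; it stays in the complex field, where the norms live. *)
pose phi x : C := `|x| ^+ 2 - (f x + (f x)^*).
have phi_real x : phi x \is Num.real.
  by rewrite rpredB ?realX ?normr_real // CrealE rmorphD /= conjCK addrC.
have phi_ge x : - K ^+ 2 <= phi x.
  have h1 : f x + (f x)^* <= 2%:R * (K * `|x|).
    apply: le_trans (_ : `|f x + (f x)^*| <= _).
      by rewrite real_ler_norm // CrealE rmorphD /= conjCK addrC.
    apply: le_trans (ler_normD _ _) _.
    by rewrite norm_conjC mulr_natl mulr2n lerD // bf.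
  rewrite /phi lerBrDr -lerBrDl opprK (le_trans h1) //.
  rewrite -subr_ge0.
  have -> : `|x| ^+ 2 + K ^+ 2 - 2%:R * (K * `|x|) = (`|x| - K) ^+ 2 by ring.
  by rewrite real_exprn_even_ge0 // realB // ?normr_real // ger0_real.
pose A := [set complex.Re (phi x) | x in [set: H]].
have infA : has_inf A.
  split; first by exists (complex.Re (phi 0)); exists 0.
  exists (complex.Re (- K ^+ 2)) => _ [x _ <-]; exact: ler_Re.
pose mu : C := (inf A)%:C%C.
have mu_le x : mu <= phi x.
  rewrite -(RRe_real (phi_real x)) lecR; apply: ge_inf; first by case: infA.
  by exists x.
have ex n : exists x, phi x <= mu + n.+1%:R^-1.
  have e0 : 0 < n.+1%:R^-1 :> R by rewrite invr_gt0.
  have [_ [x _ <-] lt] := inf_adherent e0 infA; exists x.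
  rewrite -(RRe_real (phi_real x)) /mu -(rmorph_nat (real_complex R)).
  by rewrite -fmorphV -rmorphD lecR ltW.
have [xs xsP] := choice ex.
(* Parallelogram identity, for the quadratic functional. *)
have para x y : `|x - y| ^+ 2 = 2%:R * (phi x + phi y) - 4%:R * phi (2%:R^-1 *: (x + y)).
  rewrite /phi normrZ exprMn normfV normr_nat fZ fD !rmorphM !rmorphD /=.
  rewrite fmorphV rmorph_nat !dotE.
  rewrite hdotBl !hdotBr hdotDl !hdotDr.
  by field.
have xs_dist n k : `|xs n - xs k| ^+ 2 <= 2%:R * (n.+1%:R^-1 + k.+1%:R^-1).
  rewrite para lerBlDr.
  apply: le_trans (_ : 2%:R * (mu + n.+1%:R^-1 + (mu + k.+1%:R^-1)) <= _).
    by rewrite ler_pM2l // lerD.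
  rewrite addrACA mulrDr [leRHS]addrC lerD2r -mulr2n -[mu *+ 2]mulr_natl mulrA -natrM.
  by rewrite ler_pM2l.
have cvx : cvg (xs @ \oo).
  apply/cauchy_cvgP/cauchy_exP => e e0.
  have e24 : 0 < e ^+ 2 / 4%:R by rewrite divr_gt0 // exprn_gt0.
  have [N NP] := small_invn e24.
  exists (xs N); exists N => // n /= Nn.
  rewrite -ball_normE /ball_ /= -(@ltr_pXn2r _ 2) ?nnegrE ?(ltW e0) //.
  apply: le_lt_trans (xs_dist _ _) _.
  have := ltrD (NP N (leqnn N)) (NP n Nn).
  rewrite -(ltr_pM2l (ltr0n C 2)).
  have -> // : 2%:R * (e ^+ 2 / 4%:R + e ^+ 2 / 4%:R) = e ^+ 2 by field.
pose z := lim (xs @ \oo).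
(* First variation at an almost minimal point, in the best direction t v. *)
have var n v : `|dot (xs n) v - (f v)^*| ^+ 2 <= n.+1%:R^-1 * `|v| ^+ 2.
  have [->|v0] := eqVneq v 0.
    by rewrite hdot0r f0 rmorph0 subrr !normr0 expr0n mulr0.
  have nv : 0 < `|v| ^+ 2 by rewrite exprn_gt0 // normr_gt0.
  set D := dot _ _ - _; pose t := - (D / `|v| ^+ 2).
  have := mu_le (t *: v + xs n).
  have -> : phi (t *: v + xs n) = phi (xs n) - `|D| ^+ 2 / `|v| ^+ 2.
    rewrite /phi !dotE fD fZ !hdotDl !hdotDr !hdotZl !hdotZr.
    rewrite normCK.
    have vr : (dot v v)^* = dot v v by rewrite -hdotC.
    have tc : t^* = - (D^* / dot v v).
      by rewrite /t dotE rmorphN rmorphM fmorphV /= vr.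
    rewrite rmorphD rmorphM /= tc /t dotE /D rmorphB /= conjCK -hdotC.
    have d0 : dot v v != 0 by rewrite -dotE gt_eqF.
    by field.
  rewrite lerBrDr => /le_trans /(_ (xsP n)); rewrite lerD2l.
  by rewrite ler_pdivrMr.
exists z => v.
suff : `|dot z v - (f v)^*| <= 0.
  rewrite normr_le0 subr_eq0 => /eqP e.
  by rewrite hdotC e conjCK.
apply: (@ler_small _ _ _ (2%:R * `|v|)); rewrite ?mulr_ge0 // => e e0.
have [N NP] := small_invn (exprn_gt0 2 e0).
have /cvgrPdist_lt /(_ e e0) [N' _ N'P] := cvx.
pose n := maxn N N'.
have zn : `|z - xs n| < e by apply: N'P; rewrite /= leq_maxr.
have dn : n.+1%:R^-1 < e ^+ 2 by apply: NP; rewrite leq_maxl.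
have -> : dot z v - (f v)^* = dot (z - xs n) v + (dot (xs n) v - (f v)^*).
  by rewrite hdotBl addrA subrK.
apply: le_trans (ler_normD _ _) _; rewrite add0r -mulrA mulr_natl mulr2n lerD //.
  apply: le_trans (hdot_cauchy_schwarz _ _) _.
  by rewrite mulrC ler_wpM2l // ltW.
rewrite -(@ler_pXn2r _ 2) ?nnegrE ?mulr_ge0 ?(ltW e0) // exprMn.
apply: le_trans (var _ _) _; rewrite mulrC ler_wpM2l ?exprn_ge0 //.
exact: ltW.
Qed.


End Riesz.

(** * Adjoints of contractions, and positive operators of finite rank *)
Section Adjoint.
Variables (R : realType) (H : completeNormedModType R[i]).
Variable dot : {dot H for (@Num.conj R[i])}.
Hypothesis dotE : hilbert_dot dot.
Implicit Types x y z : H.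

Lemma contraction_le (T : {linear H -> H}) x : contraction_op T -> `|T x| <= `|x|.
Proof.
move=> [[M TM] T1].
have [->|x0] := eqVneq x 0; first by rewrite linear0 normr0.
have nx : 0 < `|x| by rewrite normr_gt0.
have ub : has_ubound [set complex.Re `|T x| | x in [set x : H | `|x| <= 1]].
  exists (complex.Re (`|M|)) => _ [y /= y1 <-]; apply: (@ler_Re _ `|T y| `|M|).
  apply: le_trans (_ : `|M| * `|y| <= _); last by rewrite ler_piMr.
  have [->|y0] := eqVneq y 0; first by rewrite linear0 !normr0 mulr0.
  have ny : 0 < `|y| by rewrite normr_gt0.
  have : 0 <= M by rewrite -(pmulr_lge0 _ ny) (le_trans _ (TM y)).
  by move=> M0; rewrite (ger0_norm M0) TM.
have y1 : `| `|x|^-1 *: x| <= 1.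
  by rewrite normrZ normfV normr_id mulVf ?gt_eqF.
have : complex.Re `|T (`|x|^-1 *: x)| <= 1.
  by apply: le_trans T1; apply: ub_le_sup => //; exists (`|x|^-1 *: x).
rewrite -lecR -ge0_ReE //.
by rewrite linearZ normrZ normfV normr_id ler_pdivrMl // mulr1.
Qed.

Variables (T : {linear H -> H}) (Tc : contraction_op T).
Local Notation S := (adjoint dot T).

Lemma adjointP x y : dot (T x) y = dot x (S y).
Proof.
have [|a u v|u|z zP] := @riesz _ _ _ dotE (fun x => dot (T x) y) `|y|.
- by [].
- by rewrite linearP hdotDl hdotZl.
- apply: le_trans (hdot_cauchy_schwarz dotE _ _) _.
  by rewrite mulrC ler_wpM2l // contraction_le.
have := @xgetPex _ 0 [set z | forall x, dot (T x) y = dot x z] (ex_intro _ z zP).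
exact.
Qed.

Lemma adjointPl x y : dot (S x) y = dot x (T y).
Proof. by rewrite hdotC -adjointP -hdotC. Qed.

Lemma adjoint_contraction x : `|S x| <= `|x|.
Proof.
have [->|Sx] := eqVneq (S x) 0; first by rewrite normr0.
have nS : 0 < `|S x| by rewrite normr_gt0.
rewrite -(ler_pM2l nS) -expr2 dotE -adjointP.
have := hdot_cauchy_schwarz dotE (T (S x)) x.
have r0 : 0 <= dot (T (S x)) x by rewrite adjointP -dotE exprn_ge0.
rewrite (ger0_norm r0) => /le_trans; apply.
by rewrite ler_wpM2r // contraction_le.
Qed.

Lemma iter_adjointP n x y : dot (iter n T x) y = dot x (iter n S y).
Proof. by elim: n y => //= n IH y; rewrite adjointP IH -iterSr. Qed.

End Adjoint.

Section PositiveFiniteRank.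
Variables (R : realType) (H : completeNormedModType R[i]).
Variable dot : {dot H for (@Num.conj R[i])}.
Hypothesis dotE : hilbert_dot dot.
Local Notation C := R[i].

(** Induction on the number of vectors that span the range.  If G is not
    zero, choose x0 with <G x0, x0> > 0 and subtract the rank one operator built on
    G x0.  By Cauchy-Schwarz for the form of G the difference is positive; it kills
    x0, so its range lies in the orthogonal complement of x0, which is spanned by
    one vector less. *)
Lemma psd_decomposition n (e : 'I_n -> H) (G : H -> H) :
    (forall x y, dot (G x) y = dot x (G y)) ->
    (forall x, 0 <= dot (G x) x) ->
    (forall x, exists c : 'I_n -> C, G x = \sum_i c i *: e i) ->
  exists k (g : 'I_k -> H), forall x, G x = \sum_i dot x (g i) *: g i.
Proof.
elim: n e G => [|n IH] e G symG posG spanG.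
  exists 0%N, (fun=> 0) => x; have [c ->] := spanG x.
  by rewrite !big_ord0.
have linG a x y : G (a *: x + y) = a *: G x + G y.
  apply: (hdot_inj dotE) => z; rewrite -symG !hdotDr !hdotZr !symG.
  by [].
have hl a x y z : dot (G (a *: x + y)) z = a * dot (G x) z + dot (G y) z.
  by rewrite linG hdotDl hdotZl.
have hc x y : dot (G x) y = (dot (G y) x)^* by rewrite -hdotC symG.
have [G0|/existsNP[x0 Gx0]] := pselect (forall x, dot (G x) x = 0).
  exists 0%N, (fun=> 0) => x; rewrite big_ord0.
  apply: (hdot_inj dotE) => z; rewrite hdot0r -symG.
  apply: (@sesquilinear_eq0 _ _ (fun x y => dot (G x) y)) => //= a u v w.
  by rewrite hdotDr hdotZr.
have gt0 : 0 < dot (G x0) x0 by rewrite lt_def posG andbT; apply/eqP.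
pose d := sqrtC (dot (G x0) x0).
have d0 : 0 < d by rewrite sqrtC_gt0.
have dd : d * d = dot (G x0) x0 by rewrite -expr2 sqrtCK.
have dc : d^* = d by apply/CrealP; rewrite ger0_real // ltW.
pose g0 := d^-1 *: G x0.
have dg0 x : dot x g0 = d^-1 * dot x (G x0).
  by rewrite hdotZr fmorphV /= dc.
pose G' x := G x - dot x g0 *: g0.
have symG' x y : dot (G' x) y = dot x (G' y).
  by rewrite hdotBl hdotBr symG hdotZl (hdotZr dot (dot y g0)) [dot g0 y]hdotC mulrC.
have posG' x : 0 <= dot (G' x) x.
  rewrite hdotBl hdotZl [dot g0 x]hdotC -normCK dg0 normrM exprMn subr_ge0.
  rewrite normfV (ger0_norm (ltW d0)) exprVn expr2 dd ler_pdivrMl // mulrC.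
  have := @form_cauchy_schwarz _ _ (fun x y => dot (G x) y) hl hc posG x x0 gt0.
  by rewrite -symG.
(* The rank one term is normalized so that the difference kills x0. *)
have G'x0 x : dot (G' x) x0 = 0.
  have e0 : dot x0 g0 = d by rewrite dg0 -symG -dd mulKf ?gt_eqF.
  rewrite symG' /G' e0 /g0 scalerA mulfV ?gt_eqF // scale1r subrr.
  exact: hdot0r.
have [c0 c0E] := spanG x0.
have [k ek] : exists k, dot (e k) x0 != 0.
  have [//|h] := pselect (exists k, dot (e k) x0 != 0); case: Gx0.
  rewrite c0E hdot_suml big1 // => i _; rewrite hdotZl.
  have [->|nz] := eqVneq (dot (e i) x0) 0; first by rewrite mulr0.
  by case: h; exists i.
(* As <e k, x0> is not 0, the part of the span orthogonal to x0 is spanned by the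
   projections of the other vectors along e k. *)
pose e' i := e (lift k i) - (dot (e (lift k i)) x0 / dot (e k) x0) *: e k.
have spanG' x : exists c : 'I_n -> C, G' x = \sum_i c i *: e' i.
  have [cx cxE] := spanG x.
  have {cx cxE} [c cE] : exists c : 'I_n.+1 -> C, G' x = \sum_i c i *: e i.
    exists (fun i => cx i - dot x g0 * d^-1 * c0 i).
    rewrite /G' /g0 scalerA cxE c0E scaler_sumr -sumrB.
    by apply: eq_bigr => i _; rewrite scalerA scalerBl.
  exists (fun i => c (lift k i)).
  have := G'x0 x; rewrite cE !(bigD1_ord k) //= hdotDl hdotZl hdot_suml => /eqP.
  rewrite addr_eq0 => /eqP ck.
  under [RHS]eq_bigr => i _ do rewrite /e' scalerBr scalerA mulrA.
  rewrite sumrB addrC; congr (_ + _).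
  rewrite -scaler_suml -mulr_suml -scaleNr; congr (_ *: _).
  apply: (mulIf ek); rewrite ck mulNr divfK //; congr (- _).
  by apply: eq_bigr => i _; rewrite hdotZl.
have [m [g gE]] := IH e' G' symG' posG' spanG'.
exists m.+1, (fun i => if unlift ord0 i is Some j then g j else g0) => x.
rewrite big_ord_recl unlift_none.
under eq_bigr => i _ do rewrite liftK.
by rewrite -gE addrC subrK.
Qed.

End PositiveFiniteRank.

(** * Families of vectors with the same sum of rank one operators *)
Section Mix.
Variables (C : nzRingType) (E : lmodType C).

Definition mix m n (A : 'M[C]_(m, n)) (a : 'I_n -> E) (i : 'I_m) : E :=
  \sum_j A i j *: a j.

Lemma mix_mul m n p (A : 'M[C]_(m, n)) (B : 'M[C]_(n, p)) a i :
  mix (A *m B) a i = mix A (mix B a) i.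
Proof.
rewrite /mix; under eq_bigr => j _ do rewrite mxE scaler_suml.
rewrite exchange_big; apply: eq_bigr => k _ /=.
by rewrite scaler_sumr; apply: eq_bigr => j _; rewrite scalerA.
Qed.

Lemma mix1 m (a : 'I_m -> E) i : mix 1%:M a i = a i.
Proof.
rewrite /mix (bigD1 i) //= big1 ?addr0 ?mxE ?eqxx ?scale1r // => j ne.
by rewrite mxE eq_sym (negbTE ne) scale0r.
Qed.

Lemma eq_mix m n (A : 'M[C]_(m, n)) a b i : a =1 b -> mix A a i = mix A b i.
Proof. by move=> ab; apply: eq_bigr => j _; rewrite ab. Qed.

End Mix.

Section UnitaryBlocks.
Variables (C : numClosedFieldType) (n : nat).

Lemma bigD1_lift (V : nmodType) (k : 'I_n.+1) (F : 'I_n.+1 -> V) :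
  \sum_i F i = F k + \sum_i F (lift k i).
Proof. by rewrite (bigD1_ord k). Qed.

(** The block diagonal matrix of 1 and [U].  Its entries are given through
    [unlift], which fits sums split by [big_ord_recl]. *)
Definition extend1 (U : 'M[C]_n) : 'M[C]_n.+1 := \matrix_(i, j)
  match unlift ord0 i, unlift ord0 j with
  | Some i', Some j' => U i' j'
  | None, None => 1
  | _, _ => 0
  end.

Lemma extend1_unitary U : U \is unitarymx -> extend1 U \is unitarymx.
Proof.
move=> /mulmxV_unitary /matrixP UU; apply/unitarymxP/matrixP => i j.
rewrite !mxE big_ord_recl !mxE unlift_none.
under eq_bigr => k _ do rewrite !mxE liftK.
case: unliftP => [i' ->|->]; case: unliftP => [j' ->|->].
- rewrite mul0r add0r (inj_eq lift_inj); have := UU i' j'; rewrite !mxE => <-.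
  by apply: eq_bigr => k _; rewrite !mxE.
- rewrite mul0r add0r big1 ?eq_liftF // => k _.
  by rewrite rmorph0 mulr0.
- by rewrite rmorph0 mulr0 add0r big1 // => k _; rewrite mul0r.
- by rewrite rmorph1 mulr1 big1 ?addr0 // => k _; rewrite mul0r.
Qed.

Lemma mix_extend1 (E : lmodType C) U (a : 'I_n.+1 -> E) :
  mix (extend1 U) a ord0 = a ord0 /\
  forall i, mix (extend1 U) a (lift ord0 i) = mix U (fun j => a (lift ord0 j)) i.
Proof.
rewrite /mix; split=> [|i]; rewrite big_ord_recl !mxE !unlift_none ?liftK.
  rewrite scale1r big1 ?addr0 // => i _.
  by rewrite mxE unlift_none liftK scale0r.
rewrite scale0r add0r; apply: eq_bigr => j _.
by rewrite mxE !liftK.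
Qed.

(** A row with a single nonzero entry, of modulus one, forces the rest of its
    column to vanish. *)
Lemma unitary_drop (U : 'M[C]_n.+1) k mu : U \is unitarymx -> `|mu| = 1 ->
    (forall j, U k j = mu *+ (j == k)) ->
  (forall i, U (lift k i) k = 0) /\
  (\matrix_(i, j) U (lift k i) (lift k j) \is unitarymx).
Proof.
move=> /mulmxV_unitary /matrixP UU mu1 Uk.
have col i : U (lift k i) k = 0.
  have := UU (lift k i) k; rewrite !mxE (bigD1_lift k) big1 => [|j _]; last first.
    by rewrite !mxE Uk eq_sym eq_liftF rmorph0 mulr0.
  rewrite !mxE Uk eqxx mulr1n addr0 eq_sym eq_liftF => /eqP.
  by rewrite mulf_eq0 conjC_eq0 -normr_eq0 orbC -normr_eq0 mu1 oner_eq0 normr_eq0 => /eqP.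
split=> //; apply/unitarymxP/matrixP => i j.
have := UU (lift k i) (lift k j).
rewrite !mxE (bigD1_lift k) col mul0r add0r (inj_eq lift_inj) => <-.
by apply: eq_bigr => l _; rewrite !mxE.
Qed.

End UnitaryBlocks.

Section UnitaryFreedom.
Variables (R : realType) (H : completeNormedModType R[i]).
Variable dot : {dot H for (@Num.conj R[i])}.
Hypothesis dotE : hilbert_dot dot.
Local Notation C := R[i].

(** The conjugates of the coefficients <x, a_i>: with this choice the row
    is linear in the family [a]. *)
Definition coords n (a : 'I_n -> H) (x : H) : 'rV[C]_n := \row_i dot (a i) x.

Lemma coords_mix m n (A : 'M[C]_(m, n)) a x :
  coords (mix A a) x = coords a x *m A^T.
Proof.
apply/rowP => i; rewrite !mxE hdot_suml; apply: eq_bigr => j _.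
by rewrite hdotZl !mxE mulrC.
Qed.

Lemma coords_linear n (a : 'I_n -> H) c x y :
  coords a (c *: x + y) = c^* *: coords a x + coords a y.
Proof. by apply/rowP => i; rewrite !mxE hdotDr hdotZr. Qed.

Lemma coords_polar n (a b : 'I_n -> H) :
    (forall x, '[coords a x] = '[coords b x]) ->
  forall x y, '[coords a x, coords a y] = '[coords b x, coords b y].
Proof.
move=> ab x y; apply/eqP; rewrite -subr_eq0; apply/eqP.
apply: (sesquilinear_eq0 (h := fun y x =>
  '[coords a x, coords a y] - '[coords b x, coords b y])) => [c u v w|c u v w|u].
- by rewrite !coords_linear !linearDr !linearZr_LR /= conjCK mulrBr opprD addrACA.
- by rewrite !coords_linear !linearDl !linearZl_LR /= mulrBr opprD addrACA.
- by rewrite ab subrr.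
Qed.

Lemma unitary_to_axis n (u : 'rV[C]_n.+1) (rho : C) : '[u] = `|rho| ^+ 2 ->
  exists2 P, P \is unitarymx & u *m P = rho *: delta_mx 0 (@ord0 n).
Proof.
move=> urho; have [|tau [Pu uP]] := @exists_unitary_moving C n.+1 u (rho *: delta_mx 0 ord0).
  by rewrite dotmxZ dotmx_delta_r mxE !eqxx mulr1.
by eexists; first exact: Pu.
Qed.

(** Unitary freedom of decompositions into rank one operators.  Rotate both
    families so that a given x0 has its coordinates along the first axis; by
    polarization the first vectors then agree, and the induction applies to the
    others. *)
Lemma unitary_freedom n (a b : 'I_n -> H) :
    (forall x, '[coords a x] = '[coords b x]) ->
  exists2 U, U \is unitarymx & forall i, b i = mix U a i.
Proof.
elim: n a b => [|n IH] a b ab.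
  exists 1%:M; last by case.
  by apply/unitarymxP; rewrite trmx1 map_mx1 mulmx1.
have [a0|/existsNP[x0 ax0]] := pselect (forall x, coords a x = 0).
  exists 1%:M => [|i].
    by apply/unitarymxP; rewrite trmx1 map_mx1 mulmx1.
  rewrite mix1; apply: (hdot_inj dotE) => z; rewrite [LHS]hdotC [RHS]hdotC.
  have /eqP := ab z; rewrite a0 linear0l eq_sym dnorm_eq0 => /eqP b0.
  by have /rowP/(_ i) := b0; have /rowP/(_ i) := a0 z; rewrite !mxE => -> ->.
have [rho rho0 arho] : exists2 rho : C, rho != 0 & '[coords a x0] = `|rho| ^+ 2.
  exists (sqrtC '[coords a x0]); first by rewrite sqrtC_eq0 dnorm_eq0; apply/eqP.
  by rewrite -[X in X = _]sqrtCK ger0_norm // sqrtC_ge0 dnorm_ge0.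
have brho := arho; rewrite ab in brho.
have [P Pu aP] := unitary_to_axis arho.
have [Q Qu bQ] := unitary_to_axis brho.
(* After the rotations x0 has the same coordinates, along the first axis, for
   both families. *)
pose a' := mix P^T a; pose b' := mix Q^T b.
have a'x0 : coords a' x0 = rho *: delta_mx 0 (@ord0 n).
  by rewrite coords_mix trmxK; exact: aP.
have b'x0 : coords b' x0 = rho *: delta_mx 0 (@ord0 n).
  by rewrite coords_mix trmxK; exact: bQ.
have ab' x : '[coords a' x] = '[coords b' x].
  by rewrite !coords_mix !trmxK (dotmx_unitary _ _ Pu) (dotmx_unitary _ _ Qu).
have ab0 : a' ord0 = b' ord0.
  apply: (hdot_inj dotE) => z; rewrite [LHS]hdotC [RHS]hdotC; congr (_^*).
  have := coords_polar ab' z x0; rewrite a'x0 b'x0 !linearZr_LR /= !dotmx_delta_r.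
  by rewrite !mxE => /mulfI; apply; rewrite conjC_eq0.
have [U Uu UE] : exists2 U, U \is unitarymx &
    forall i, b' (lift ord0 i) = mix U (fun j => a' (lift ord0 j)) i.
  apply: IH => x; have := ab' x; rewrite !dotmxx_sum !big_ord_recl !mxE ab0.
  by move=> /addrI; under eq_bigr do rewrite mxE; move=> e;
     under eq_bigr do rewrite mxE; rewrite e; apply: eq_bigr => i _; rewrite !mxE.
have PTu : P^T \is unitarymx by rewrite trmx_unitary.
have QTu : Q^T \is unitarymx by rewrite trmx_unitary.
have [e0 eS] := mix_extend1 U a'.
have bE : b' =1 mix (extend1 U) a'.
  move=> i; case: (unliftP ord0 i) => [j|] ->; first by rewrite eS.
  by rewrite e0 ab0.
exists ((Q^T)^t* *m (extend1 U *m P^T)) => [|i].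
  apply: mul_unitarymx; first by rewrite trmxC_unitary; exact: QTu.
  exact: mul_unitarymx (extend1_unitary Uu) PTu.
rewrite mix_mul (@eq_mix _ _ _ _ _ _ b') => [|j]; last by rewrite mix_mul bE.
by rewrite -mix_mul mulVmx_unitary // mix1.
Qed.

End UnitaryFreedom.

(** * Colligations and the removal of unimodular eigenvectors *)
Section Colligation.
Variables (R : realType) (H : completeNormedModType R[i]).
Variable dot : {dot H for (@Num.conj R[i])}.
Hypothesis dotE : hilbert_dot dot.
Local Notation C := R[i].

Definition rank_op n (h : 'I_n -> H) (x : H) : H := \sum_i dot x (h i) *: h i.

Lemma dot_rank_op n (h : 'I_n -> H) x y :
  dot (rank_op h x) y = '[coords dot h y, coords dot h x].
Proof.
rewrite hdot_suml dotmx_sum; apply: eq_bigr => i _.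
by rewrite hdotZl !mxE -hdotC mulrC.
Qed.

Lemma rank_op_mix n (P : 'M[C]_n) (h : 'I_n -> H) x : P \is unitarymx ->
  rank_op (mix P h) x = rank_op h x.
Proof.
move=> Pu; apply: (hdot_inj dotE) => z; rewrite [LHS]hdotC [RHS]hdotC.
have PTu : P^T \is unitarymx by rewrite trmx_unitary; exact: Pu.
by rewrite !dot_rank_op !coords_mix (dotmx_unitary _ _ PTu).
Qed.

Lemma eq_rank_op n (h h' : 'I_n -> H) x : h =1 h' -> rank_op h x = rank_op h' x.
Proof. by move=> hh; apply: eq_bigr => i _; rewrite hh. Qed.

Lemma pure_small (T : H -> H) (h : H) (e : C) : is_pure dot T -> 0 < e ->
  exists N, forall n, (N <= n)%N -> `|iter n (adjoint dot T) h| < e.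
Proof.
move=> /(_ h) /cvgrPdist_lt /(_ e) P e0; have [N _ NP] := P e0.
by exists N => n /NP; rewrite /= sub0r normrN normr_id.
Qed.

(** |<g, g>| = |<T^n g, g>| = |<g, S^n g>| tends to 0, for S the adjoint of T. *)
Lemma pure_no_eigenvector (T : {linear H -> H}) mu g :
    contraction_op T -> is_pure dot T -> `|mu| = 1 -> T g = mu *: g -> g = 0.
Proof.
move=> Tc Tp mu1 Tg; apply/eqP; rewrite -normr_eq0.
rewrite -(@eqrXn2 _ 2 _ 0) // expr0n /=.
rewrite eq_le exprn_ge0 // andbT.
apply: (@ler_small _ _ _ `|g|) => // e e0; rewrite add0r.
have [N NP] := pure_small g Tp e0.
have iT n : iter n T g = mu ^+ n *: g.
  by elim: n => [|n IH]; rewrite ?scale1r // iterS IH linearZ /= Tg scalerA -exprSr.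
have -> : `|g| ^+ 2 = `|dot (iter N T g) g|.
  by rewrite iT hdotZl normrM normrX mu1 expr1n mul1r -dotE normrX normr_id.
rewrite (iter_adjointP dotE Tc).
apply: le_trans (hdot_cauchy_schwarz dotE _ _) _.
by rewrite ler_wpM2l // ltW // NP.
Qed.

Section ClassMix.
Variables (m : nat) (s : pred 'I_m).

(** A matrix that does not mix the two classes commutes with operations
    that depend on the class only. *)
Lemma class_mix (P : 'M[C]_m) (f1 f2 : {linear H -> H}) g i :
    (forall i j, s i != s j -> P i j = 0) ->
  (if s i then f1 (mix P g i) else f2 (mix P g i)) =
  mix P (fun j => if s j then f1 (g j) else f2 (g j)) i.
Proof.
move=> Ps; case: ifP => si; rewrite /mix linear_sum; apply: eq_bigr => j _;
  rewrite linearZ /=; have := Ps i j; rewrite si; case: (s j) => // -> //.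
- by rewrite !scale0r.
- by rewrite !scale0r.
Qed.

(** The unitary moves a basis vector of the class to the normalized [v];
    as both are supported in the class it does not mix the classes. *)
Lemma unitary_in_class (t : pred 'I_m) (v : 'rV[C]_m) :
    t =1 s \/ t =1 predC s ->
    v != 0 -> v *m proj t = v ->
  exists P c k, [/\ P \is unitarymx, c != 0, row k P = c *: v, t k &
    forall i j, s i != s j -> P i j = 0].
Proof.
move=> ts v0 vt.
have vE j : v 0 j = if t j then v 0 j else 0 by rewrite -{1}vt mulmx_projE.
have [k vk] : exists k, v 0 k != 0 by apply/rV0Pn.
have tk : t k by move: vk; rewrite vE; case: (t k) => //; rewrite eqxx.
pose c := (sqrtC '[v])^-1.
have c0 : c != 0 by rewrite invr_eq0 sqrtC_eq0 dnorm_eq0.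
have [|tau [Pu Pk]] := @exists_unitary_moving C m (delta_mx 0 k) (c *: v).
  rewrite dotmx_delta_r mxE !eqxx dotmxZ normfV ger0_norm ?sqrtC_ge0 ?dnorm_ge0 //.
  by rewrite exprVn sqrtCK mulVf // dnorm_eq0.
move: Pu Pk; set w := delta_mx 0 k - _; set P := _ - _ => Pu Pk.
exists P, c, k; split=> //; first by rewrite rowE.
have wt j : ~~ t j -> w 0 j = 0.
  move=> tj; rewrite !mxE vE (negbTE tj) mulr0 subr0.
  by rewrite (_ : (j == k) = false) ?andbF //; apply: contraNF tj => /eqP ->.
move=> i j sij; have ij : i != j by apply: contraNneq sij => ->.
rewrite !mxE (negbTE ij) big_ord1 !mxE sub0r.
have : (~~ t i) || (~~ t j).
  by case: ts => ts; rewrite !ts /=; move: sij; case: (s i); case: (s j).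
by case/orP => /wt; rewrite !mxE => ->; rewrite ?rmorph0 ?mul0r ?mulr0 ?oppr0.
Qed.
End ClassMix.

Variables (T1 T2 : {linear H -> H}).
Hypotheses (T1c : contraction_op T1) (T2c : contraction_op T2).
Hypothesis T12 : forall h, T1 (T2 h) = T2 (T1 h).
Local Notation S1 := (adjoint dot T1).
Local Notation S2 := (adjoint dot T2).

(** The coordinates where [s] holds carry the decomposition of I - T1 S1.
    On the others, [g] is tied to [T1] and [T2] by the last clause only: in
    particular it need not decompose I - T2 S2, which is what allows a
    coordinate to be dropped. *)
Definition colligation m (s : pred 'I_m) (g : 'I_m -> H) (U : 'M[C]_m) :=
  [/\ U \is unitarymx,
      forall x, x - T1 (S1 x) = rank_op (fun i => if s i then g i else 0) x
    & forall i, (if s i then T2 (g i) else g i) =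
        mix U (fun j => if s j then g j else T1 (g j)) i].

(** Rotate the class of [v] so that [v] becomes a coordinate axis [k]: this
    coordinate decouples.  If it belongs to the first class, its vector
    is an eigenvector of [T2] with unimodular eigenvalue, hence zero by purity, so
    that the decomposition of I - T1 S1 is kept. *)
Lemma colligation_reduce m (s : pred 'I_m.+1) g U (t : pred 'I_m.+1) (mu : C)
    (v : 'rV[C]_m.+1) :
    colligation s g U -> t =1 s /\ is_pure dot T2 \/ t =1 predC s ->
    `|mu| = 1 -> v != 0 -> v *m proj t = v -> v *m U = mu *: v ->
  exists (s' : pred 'I_m) g' U', colligation s' g' U'.
Proof.
move=> [Uu defect inter] ts mu1 v0 vt vU.
have [] := @unitary_in_class _ s t v _ v0 vt.
  by case: ts => [[]|]; [left|right].
move=> P [c [k [Pu c0 Pk tk Ps]]].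
pose g' := mix P g; pose U' := P *m U *m P^t*.
have U'u : U' \is unitarymx.
  apply: mul_unitarymx; first exact: mul_unitarymx Pu Uu.
  by rewrite trmxC_unitary; exact: Pu.
have defect' x : x - T1 (S1 x) = rank_op (fun i => if s i then g' i else 0) x.
  rewrite defect -(rank_op_mix _ _ Pu); apply: eq_rank_op => i.
  by rewrite -(@class_mix _ s P idfun (\0 : {linear H -> H})).
have inter' i : (if s i then T2 (g' i) else g' i) =
        mix U' (fun j => if s j then g' j else T1 (g' j)) i.
  rewrite (@class_mix _ s P T2 idfun) // (eq_mix _ _ inter).
  rewrite -mix_mul /U'.
  rewrite (@eq_mix _ _ _ _ (P *m U *m P^t*) _ _ _ (fun j => @class_mix _ s P idfun T1 g j Ps)).
  by rewrite -mix_mul -(mulmxA (P *m U)) (mulVmx_unitary Pu) mulmx1.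
(* The row k of P is proportional to v, an eigenvector of U. *)
have U'k j : U' k j = mu *+ (j == k).
  have : row k U' = mu *: delta_mx 0 k.
    rewrite !row_mul Pk -scalemxAl vU scalerA mulrC -scalerA -scalemxAl -Pk.
    by rewrite -row_mul (mulmxV_unitary Pu) row1.
  by move=> /rowP/(_ j); rewrite !mxE => ->; rewrite eqxx mulr_natr.
have [U'col U''u] := unitary_drop U'u mu1 U'k.
(* In the first class, g' k is an eigenvector of T2 with eigenvalue mu. *)
have h'k : (if s k then g' k else 0) = 0.
  case: ifP => // sk; have := inter' k; rewrite sk.
  rewrite /mix (bigD1 k) //= U'k eqxx sk big1 ?addr0 => [|j /negbTE jk]; last first.
    by rewrite U'k jk scale0r.
  rewrite mulr1n => T2g; apply: pure_no_eigenvector T2c _ mu1 T2g.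
  by case: ts => [[]|ts] //; move: tk; rewrite ts /= sk.
exists (fun i => s (lift k i)), (fun i => g' (lift k i)),
  (\matrix_(i, j) U' (lift k i) (lift k j)); split => //.
- move=> x; rewrite defect' /rank_op (bigD1_lift k) h'k scaler0 add0r.
  by [].
- move=> i; rewrite inter' /mix (bigD1_lift k) U'col scale0r add0r.
  by apply: eq_bigr => j _; rewrite [in RHS]mxE.
Qed.
End Colligation.

(** * Existence of a minimal colligation *)
Section Existence.
Variables (R : realType) (H : completeNormedModType R[i]).
Variable dot : {dot H for (@Num.conj R[i])}.
Hypothesis dotE : hilbert_dot dot.
Local Notation C := R[i].

Lemma defect_decomposition (T : {linear H -> H}) :
    contraction_op T -> finite_dimensional (defect_space dot T) ->
  exists k (g : 'I_k -> H), forall x, x - T (adjoint dot T x) = rank_op dot g x.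
Proof.
move=> Tc [n [e De]]; apply: (psd_decomposition dotE (e := e)) => [x y|x|x].
- by rewrite hdotBl hdotBr (adjointP dotE Tc) -(adjointPl dotE Tc).
- rewrite hdotBl (adjointP dotE Tc) -!dotE subr_ge0 lerXn2r ?nnegrE //.
  exact: adjoint_contraction.
- have : defect_space dot T (x - T (adjoint dot T x)).
    by apply: subset_closure; exists x.
  by rewrite De => -[c _ <-]; exists c.
Qed.

Variables (T1 T2 : {linear H -> H}).
Hypotheses (T1c : contraction_op T1) (T2c : contraction_op T2).
Hypothesis T12 : forall h, T1 (T2 h) = T2 (T1 h).
Local Notation S1 := (adjoint dot T1).
Local Notation S2 := (adjoint dot T2).

Lemma adjoint_comm x : S1 (S2 x) = S2 (S1 x).
Proof.
apply: (hdot_inj dotE) => z.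
by rewrite -!(adjointP dotE T1c, adjointP dotE T2c) T12.
Qed.

Lemma sum_normsq_coords (T : {linear H -> H}) k (g : 'I_k -> H) x :
    contraction_op T -> (forall x, x - T (adjoint dot T x) = rank_op dot g x) ->
  '[coords dot g x] = `|x| ^+ 2 - `|adjoint dot T x| ^+ 2.
Proof.
by move=> Tc gE; rewrite -dot_rank_op -gE hdotBl (adjointP dotE Tc) -!dotE.
Qed.

(** The two families compared are those of (I - T1 S1) + T1 (I - T2 S2) S1
    and (I - T2 S2) + T2 (I - T1 S1) S2, which are equal since [T1] and [T2]
    commute. *)
Lemma colligation_exists :
    finite_dimensional (defect_space dot T1) ->
    finite_dimensional (defect_space dot T2) ->
  exists m (s : pred 'I_m) g U, colligation dot T1 T2 s g U.
Proof.
move=> /(defect_decomposition T1c)[k1 [g1 g1E]].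
move=> /(defect_decomposition T2c)[k2 [g2 g2E]].
pose s : pred 'I_(k1 + k2) := fun i => if fintype.split i is inl _ then true else false.
pose g i := match fintype.split i with inl j => g1 j | inr j => g2 j end.
have sl j : s (lshift k2 j) by rewrite /s (unsplitK (inl j)).
have sr j : s (rshift k1 j) = false by rewrite /s (unsplitK (inr j)).
have gl j : g (lshift k2 j) = g1 j by rewrite /g (unsplitK (inl j)).
have gr j : g (rshift k1 j) = g2 j by rewrite /g (unsplitK (inr j)).
have sumE (T : {linear H -> H}) k (h : 'I_k -> H) x : contraction_op T ->
    \sum_i `|dot (T (h i)) x| ^+ 2 = '[coords dot h (adjoint dot T x)].
  move=> Tc; rewrite dotmxx_sum; apply: eq_bigr => i _.
  by rewrite mxE (adjointP dotE Tc).
have sum0 k (h : 'I_k -> H) x : \sum_i `|dot (h i) x| ^+ 2 = '[coords dot h x].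
  by rewrite dotmxx_sum; apply: eq_bigr => i _; rewrite mxE.
have [|U Uu UE] := @unitary_freedom _ _ _ dotE (k1 + k2)
    (fun j => if s j then g j else T1 (g j)) (fun j => if s j then T2 (g j) else g j).
  move=> x; rewrite !dotmxx_sum !big_split_ord /=.
  under eq_bigr => i _ do rewrite mxE sl gl.
  under [in X in _ + X = _]eq_bigr => i _ do rewrite mxE sr gr.
  under [in X in _ = X + _]eq_bigr => i _ do rewrite mxE sl gl.
  under [in X in _ = _ + X]eq_bigr => i _ do rewrite mxE sr gr.
  rewrite !sumE // !sum0 !(sum_normsq_coords _ T1c g1E, sum_normsq_coords _ T2c g2E).
  by rewrite adjoint_comm; ring.
exists (k1 + k2)%N, s, g, U; split=> // x.
rewrite g1E /rank_op big_split_ord /= [X in _ = _ + X]big1 ?addr0 => [|i _].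
  by apply: eq_bigr => i _; rewrite sl gl.
by rewrite sr scaler0.
Qed.

Lemma minimal_colligation_exists :
    finite_dimensional (defect_space dot T1) ->
    finite_dimensional (defect_space dot T2) ->
  exists m (s : pred 'I_m) g U, [/\ colligation dot T1 T2 s g U,
    no_unimodular_eigenvector (predC s) U &
    is_pure dot T2 -> no_unimodular_eigenvector s U].
Proof.
move=> D1 D2; pose P m := `[< exists (s : pred 'I_m) g U, colligation dot T1 T2 s g U >].
have exP : exists m, P m.
  have [m [s [g [U c]]]] := colligation_exists D1 D2.
  by exists m; apply/asboolP; exists s, g, U.
case: (ex_minnP exP) => m /asboolP[s [g [U c]]] minm; exists m, s, g, U.
have key (t : pred 'I_m) : t =1 s /\ is_pure dot T2 \/ t =1 predC s ->
    no_unimodular_eigenvector t U.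
  move=> ts mu v mu1 vt vU; apply/eqP; apply: contraT => v0.
  case: m s g U c minm t ts v vt vU v0 {exP} => [|m] s g U c minm t ts v vt vU v0.
    by rewrite [v]thinmx0 eqxx in v0.
  have ex := colligation_reduce dotE T2c c ts mu1 v0 vt vU.
  by have := minm m (asboolT ex); rewrite ltnn.
by split=> // [|p2]; apply: key; [right|left].
Qed.
End Existence.

(** * Polynomials in one operator *)
Section OperatorPolynomial.
Variables (C : nzRingType) (H : lmodType C).

(** The operator f(T), applied to [h]. *)
Definition opoly (T : H -> H) (f : {poly C}) (h : H) : H :=
  \sum_(n < size f) f`_n *: iter n T h.

Lemma opoly_widen T N (f : {poly C}) h : (size f <= N)%N ->
  opoly T f h = \sum_(n < N) f`_n *: iter n T h.
Proof.
move=> sN; rewrite /opoly (big_ord_widen N (fun n => f`_n *: iter n T h)) //.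
rewrite big_mkcond; apply: eq_bigr => i _; case: ltnP => // le.
by rewrite nth_default // scale0r.
Qed.

Lemma opolyD T f g h : opoly T (f + g) h = opoly T f h + opoly T g h.
Proof.
rewrite (@opoly_widen _ (maxn (size f) (size g)) (f + g)) ?size_polyD //.
rewrite (@opoly_widen _ (maxn (size f) (size g)) f) ?leq_maxl //.
rewrite (@opoly_widen _ (maxn (size f) (size g)) g) ?leq_maxr //.
by rewrite -big_split; apply: eq_bigr => i _; rewrite coefD scalerDl.
Qed.

Lemma opoly0 T h : opoly T 0 h = 0.
Proof. by rewrite /opoly size_poly0 big_ord0. Qed.

Lemma opoly_sum T I (r : seq I) (P : pred I) (F : I -> {poly C}) h :
  opoly T (\sum_(i <- r | P i) F i) h = \sum_(i <- r | P i) opoly T (F i) h.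
Proof. by apply: (big_morph (fun f => opoly T f h)) => [f g|]; rewrite ?opolyD ?opoly0. Qed.

Lemma opolyZ T a f h : opoly T (a *: f) h = a *: opoly T f h.
Proof.
rewrite (@opoly_widen _ (size f) (a *: f)) ?size_scale_leq // scaler_sumr.
by apply: eq_bigr => i _; rewrite coefZ scalerA.
Qed.

Lemma opolyX (T : {linear H -> H}) f h : opoly T ('X * f) h = T (opoly T f h).
Proof.
have sX : (size (f * 'X)%R <= (size f).+1)%N.
  by rewrite (leq_trans (size_polyMleq _ _)) // size_polyX addn2.
rewrite -commr_polyX (opoly_widen _ _ sX) big_ord_recl coefMX eqxx scale0r add0r.
by rewrite linear_sum; apply: eq_bigr => i _; rewrite coefMX /= linearZ.
Qed.

Lemma opoly_comm (T S : {linear H -> H}) f h : (forall x, T (S x) = S (T x)) ->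
  S (opoly T f h) = opoly T f (S h).
Proof.
move=> TS; rewrite linear_sum; apply: eq_bigr => i _; rewrite linearZ /=.
by congr (_ *: _); elim: (nat_of_ord i) => //= n IH; rewrite -TS IH.
Qed.

End OperatorPolynomial.

Lemma opoly_sumr (C : comNzRingType) (H : lmodType C) (T : {linear H -> H}) f
    m (c : 'I_m -> C) (a : 'I_m -> H) :
  opoly T f (\sum_i c i *: a i) = \sum_i opoly T (f * (c i)%:P) (a i).
Proof.
under [RHS]eq_bigr => i _ do rewrite mulrC mul_polyC opolyZ.
have iterL n : iter n T (\sum_i c i *: a i) = \sum_i c i *: iter n T (a i).
  elim: n => //= n ->; rewrite linear_sum; apply: eq_bigr => i _.
  by rewrite linearZ.
rewrite /opoly; under [LHS]eq_bigr => n _ do rewrite iterL scaler_sumr.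
rewrite exchange_big; apply: eq_bigr => i _; rewrite scaler_sumr.
by apply: eq_bigr => n _; rewrite !scalerA mulrC.
Qed.

Section Pairing.
Variables (C : comNzRingType) (H : lmodType C) (T : {linear H -> H}).

Definition pairing m (v : 'rV[{poly C}]_m) (a : 'I_m -> H) : H :=
  \sum_i opoly T (v 0 i) (a i).

Variable m : nat.
Implicit Types (v w : 'rV[{poly C}]_m) (a b : 'I_m -> H).

Lemma pairingD v w a : pairing (v + w) a = pairing v a + pairing w a.
Proof. by rewrite -big_split; apply: eq_bigr => i _; rewrite mxE opolyD. Qed.

Lemma pairing_sum I (r : seq I) (P : pred I) (F : I -> 'rV[{poly C}]_m) a :
  pairing (\sum_(i <- r | P i) F i) a = \sum_(i <- r | P i) pairing (F i) a.
Proof.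
apply: (big_morph (fun f => pairing f a)) => [f g|]; rewrite ?pairingD //.
by rewrite /pairing big1 // => i _; rewrite mxE opoly0.
Qed.

Lemma pairingZ (c : C) v a : pairing (c%:P *: v) a = c *: pairing v a.
Proof.
rewrite scaler_sumr; apply: eq_bigr => i _.
by rewrite mxE mul_polyC opolyZ.
Qed.

Lemma pairingX v a : pairing ('X *: v) a = T (pairing v a).
Proof.
by rewrite linear_sum; apply: eq_bigr => i _; rewrite mxE opolyX.
Qed.

Lemma pairingXn n v a : pairing ('X^n *: v) a = iter n T (pairing v a).
Proof.
elim: n => [|n IH]; first by rewrite expr0 scale1r.
by rewrite exprS -scalerA pairingX IH.
Qed.

Lemma pairing_comm (S : {linear H -> H}) v a : (forall x, T (S x) = S (T x)) ->
  S (pairing v a) = pairing v (fun i => S (a i)).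
Proof.
by move=> TS; rewrite linear_sum; apply: eq_bigr => i _; rewrite opoly_comm.
Qed.

Lemma pairing_mix n v (A : 'M[C]_(m, n)) (a : 'I_n -> H) :
  pairing (v *m map_mx (@polyC C) A) a = pairing v (mix A a).
Proof.
rewrite /pairing /mix; under [RHS]eq_bigr => i _ do rewrite opoly_sumr.
rewrite exchange_big; apply: eq_bigr => j _ /=.
by rewrite mxE opoly_sum; apply: eq_bigr => i _; rewrite mxE.
Qed.

Lemma eq_pairing_proj (t : pred 'I_m) v a b : (forall i, t i -> a i = b i) ->
  pairing (v *m proj t) a = pairing (v *m proj t) b.
Proof.
move=> ab; apply: eq_bigr => i _; rewrite mulmx_projE.
by case: ifP => [ti|_]; [rewrite ab|rewrite !opoly0].
Qed.

End Pairing.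

(** * The von Neumann inequality of a colligation *)
Section SmallPowers.
Variable R : realType.
Local Notation C := R[i].

Lemma bernoulli (d : C) n : 0 <= d -> 1 + n%:R * d <= (1 + d) ^+ n.
Proof.
move=> d0; elim: n => [|n IH]; first by rewrite mul0r addr0.
rewrite exprS -natr1; have d1 : 0 <= 1 + d by rewrite addr_ge0.
apply: le_trans (ler_wpM2l d1 IH); rewrite -subr_ge0.
have -> : (1 + d) * (1 + n%:R * d) - (1 + (n%:R + 1) * d) = n%:R * d ^+ 2 by ring.
by rewrite mulr_ge0 ?exprn_ge0.
Qed.

Lemma small_expVn (r e : C) : 1 < `|r| -> 0 < e -> exists n, `|r ^- n| < e.
Proof.
move=> r1 e0; pose d := `|r| - 1; have d0 : 0 < d by rewrite subr_gt0.
have rd : 1 + d = `|r| by rewrite /d addrC subrK.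
have [N NP] := small_invn (mulr_gt0 e0 d0); exists N.+1.
have N0 : 0 < N.+1%:R :> C by rewrite ltr0n.
have r0 : 0 < `|r| := lt_trans ltr01 r1.
rewrite normfV normrX; apply: lt_trans (_ : (N.+1%:R * d)^-1 < _).
  rewrite ltf_pV2 ?posrE ?mulr_gt0 ?exprn_gt0 // -rd.
  by apply: lt_le_trans (bernoulli N.+1 (ltW d0)); rewrite ltrDr.
by rewrite invfM ltr_pdivrMr //; apply: NP.
Qed.
End SmallPowers.

Section VonNeumann.
Variables (R : realType) (H : completeNormedModType R[i]).
Variable dot : {dot H for (@Num.conj R[i])}.
Hypothesis dotE : hilbert_dot dot.
Local Notation C := R[i].
Variables (T1 T2 : {linear H -> H}).
Hypotheses (T1c : contraction_op T1) (T2c : contraction_op T2).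
Hypothesis T12 : forall h, T1 (T2 h) = T2 (T1 h).
Local Notation S1 := (adjoint dot T1).
Variables (m : nat) (s : pred 'I_m) (g : 'I_m -> H) (U : 'M[C]_m).
Hypothesis colU : colligation dot T1 T2 s g U.
Hypothesis nondegU : no_unimodular_eigenvector (predC s) U.
Local Notation E1 := (proj s).
Local Notation E2 := (proj (predC s)).
Implicit Types c : 'rV[{poly C}]_m.

(** The sum over n and i of c_i,n T1^n g_i: the adjoint of the map from [x]
    to the sequence of the <S1^n x, g_i>, which is isometric for pure [T1]. *)
Definition synth c : H := pairing T1 (c *m E1) g.

Lemma colligation_unitary : U \is unitarymx. Proof. by case: colU. Qed.

(** The mixing relation of the colligation, paired with c + X (state): the
    contributions of the state to the two sides cancel. *)
Lemma synth_step c c' : transfer_step s U c c' -> T2 (synth c) = synth c'.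
Proof.
move=> [w wE <-]; rewrite /synth -mulmxA proj_idem.
have [_ _ inter] := colU.
pose alpha j := if s j then g j else T1 (g j).
have e1 : pairing T1 (w *m E1) alpha = pairing T1 (w *m E1) g.
  by apply: eq_pairing_proj => i si; rewrite /alpha si.
have e2 : pairing T1 (w *m E2) alpha = T1 (pairing T1 (w *m E2) g).
  rewrite (pairing_comm _ _ (S := T1)) //.
  by apply: eq_pairing_proj => i /negbTE si; rewrite /alpha si.
have : pairing T1 w alpha = T2 (pairing T1 (c *m E1) g) + T1 (pairing T1 (w *m E2) g).
  rewrite {1}wE pairing_mix pairingD pairingX; congr (_ + T1 _).
    rewrite (pairing_comm _ _ (S := T2)) //.
    by apply: eq_pairing_proj => i si; rewrite -inter si.
  by apply: eq_pairing_proj => i /negbTE si; rewrite -inter si.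
rewrite {1}(mulmx_projDC w s) pairingD e1 e2 => /addIr.
by [].
Qed.

(** The row formed by the [h i] and [T1] is coisometric, hence contractive.
    With w the combined vector, expand the squared distance from the data (a, y) to
    the coordinates of w, which is nonnegative. *)
Lemma row_contraction (h : 'I_m -> H) (a : 'I_m -> C) y :
    (forall x, x - T1 (S1 x) = rank_op dot h x) ->
  `|\sum_i a i *: h i + T1 y| ^+ 2 <= \sum_i `|a i| ^+ 2 + `|y| ^+ 2.
Proof.
move=> hE; set w := _ + _.
have wn : `|w| ^+ 2 = \sum_i `|dot w (h i)| ^+ 2 + `|S1 w| ^+ 2.
  have := sum_normsq_coords dotE w T1c hE; rewrite dotmxx_sum => e.
  apply/eqP; rewrite -subr_eq -e; apply/eqP/eq_bigr => i _.
  by rewrite mxE hdotC norm_conjC.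
have cross : \sum_i a i * (dot w (h i))^* + dot y (S1 w) = `|w| ^+ 2.
  rewrite dotE {3}/w hdotDl (adjointP dotE T1c) hdot_suml; congr (_ + _).
  by apply: eq_bigr => i _; rewrite hdotZl -hdotC.
have : 0 <= \sum_i `|a i - dot w (h i)| ^+ 2 + `|y - S1 w| ^+ 2.
  by rewrite addr_ge0 ?sumr_ge0 // => *; rewrite exprn_ge0.
have -> : \sum_i `|a i - dot w (h i)| ^+ 2 =
    \sum_i `|a i| ^+ 2 + \sum_i `|dot w (h i)| ^+ 2
    - (\sum_i a i * (dot w (h i))^* + (\sum_i a i * (dot w (h i))^*)^*).
  rewrite rmorph_sum -!big_split -sumrB; apply: eq_bigr => i _ /=.
  by rewrite !normCK rmorphB rmorphM /= conjCK; ring.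
have -> : `|y - S1 w| ^+ 2 =
    `|y| ^+ 2 + `|S1 w| ^+ 2 - (dot y (S1 w) + (dot y (S1 w))^*).
  by rewrite !dotE !hdotBl !hdotBr -[(dot y _)^*]hdotC; ring.
set A := \sum_i `|a i| ^+ 2; set X := \sum_i a i * _; set B := \sum_i `|dot _ _| ^+ 2.
have wr : (`|w| ^+ 2)^* = `|w| ^+ 2 by rewrite dotE -hdotC.
have := congr1 (fun x => x^*) cross; rewrite wr rmorphD /= => cross'.
have -> : A + B - (X + X^*) + (`|y| ^+ 2 + `|S1 w| ^+ 2 - (dot y (S1 w) + (dot y (S1 w))^*))
  = A + `|y| ^+ 2 + (B + `|S1 w| ^+ 2) - (X + dot y (S1 w)) - (X^* + (dot y (S1 w))^*) by ring.
by rewrite -wn cross cross' addrK subr_ge0.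
Qed.

Lemma sum_contraction (h : 'I_m -> H) N (a : nat -> 'I_m -> C) :
    (forall x, x - T1 (S1 x) = rank_op dot h x) ->
  `|\sum_(n < N) iter n T1 (\sum_i a n i *: h i)| ^+ 2
    <= \sum_(n < N) \sum_i `|a n i| ^+ 2.
Proof.
move=> hE; elim: N a => [|N IH] a; first by rewrite !big_ord0 normr0 expr0n.
rewrite !big_ord_recl /=; apply: le_trans (_ : _ <= \sum_i `|a 0%N i| ^+ 2 +
   `|\sum_(n < N) iter n T1 (\sum_i a n.+1 i *: h i)| ^+ 2) _.
  have -> : \sum_(i < N) T1 (iter i T1 (\sum_j a (bump 0 i) j *: h j)) =
    T1 (\sum_(n < N) iter n T1 (\sum_i a n.+1 i *: h i)) by rewrite linear_sum.
  exact: row_contraction.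
by rewrite lerD2l; apply: IH (fun n => a n.+1).
Qed.


Let h i := if s i then g i else 0.

Let hE x : x - T1 (S1 x) = rank_op dot h x.
Proof. by have [_ ->] := colU. Qed.

Lemma pairing_coef N (v : 'rV[{poly C}]_m) (a : 'I_m -> H) :
    (forall i, (size (v 0%R i) <= N)%N) ->
  pairing T1 v a = \sum_(n < N) iter n T1 (\sum_i (v 0 i)`_n *: a i).
Proof.
move=> sN; rewrite /pairing.
under eq_bigr => i _ do rewrite (opoly_widen _ _ (sN i)).
rewrite exchange_big; apply: eq_bigr => n _ /=.
have -> // : forall k, iter k T1 (\sum_i (v 0 i)`_n *: a i) =
    \sum_i (v 0 i)`_n *: iter k T1 (a i).
elim=> //= k ->; rewrite linear_sum; apply: eq_bigr => i _.
by rewrite linearZ.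
Qed.

Lemma row_sq_coef N c : (forall i, (size (c 0%R i) <= N)%N) ->
  row_sq c = \sum_(n < N) \sum_i `|(c 0 i)`_n| ^+ 2.
Proof.
move=> sN; rewrite exchange_big; apply: eq_bigr => i _ /=.
exact: coef_sq_widen.
Qed.

Lemma synth_contraction c : `|synth c| ^+ 2 <= row_sq (c *m E1).
Proof.
pose N := (\max_i size ((c *m E1) 0%R i)%R)%N.
have sN i : (size ((c *m E1) 0%R i) <= N)%N := leq_bigmax i.
have -> : synth c = pairing T1 (c *m E1) h.
  by apply: eq_pairing_proj => i si; rewrite /h si.
rewrite (pairing_coef _ sN) (row_sq_coef sN).
exact: (sum_contraction N (fun n i => ((c *m E1) 0 i)`_n) hE).
Qed.

(** Take the coefficients <S1^n x, h_i> for n < L: both sums telescope. *)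
Lemma synth_approx x L : exists c, [/\ c *m E1 = c,
  synth c = x - iter L T1 (iter L S1 x) & row_sq c <= `|x| ^+ 2].
Proof.
pose c : 'rV[{poly C}]_m := \row_i \poly_(n < L) dot (iter n S1 x) (h i).
have cE1 : c *m E1 = c.
  apply/rowP => i; rewrite mulmx_projE; case: ifP => // si; rewrite !mxE.
  apply/polyP => n; rewrite coef0 coef_poly /h si hdot0r.
  by case: ifP.
have sL i : (size (c 0%R i) <= L)%N by rewrite mxE size_poly.
exists c; split=> //.
  have -> : synth c = pairing T1 c h.
    by rewrite -{2}cE1; apply: eq_pairing_proj => i si; rewrite /h si.
  rewrite (pairing_coef _ sL).
  transitivity (\sum_(n < L) (iter n T1 (iter n S1 x) - iter n.+1 T1 (iter n.+1 S1 x))).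
    apply: eq_bigr => n _; have iterB k u v : iter k T1 (u - v) = iter k T1 u - iter k T1 v.
      by elim: k => //= k ->; rewrite linearB.
    have -> : \sum_i (c 0 i)`_n *: h i = rank_op dot h (iter n S1 x).
      by apply: eq_bigr => i _; rewrite mxE coef_poly ltn_ord.
    by rewrite -hE iterB -iterSr.
  elim: L {c cE1 sL} => [|L IH]; first by rewrite big_ord0 subrr.
  by rewrite big_ord_recr IH /= addrA subrK.
rewrite (row_sq_coef sL).
have -> : \sum_(n < L) \sum_i `|(c 0 i)`_n| ^+ 2 =
    \sum_(n < L) (`|iter n S1 x| ^+ 2 - `|iter n.+1 S1 x| ^+ 2).
  apply: eq_bigr => n _; rewrite -(sum_normsq_coords dotE _ T1c hE) dotmxx_sum.
  by apply: eq_bigr => i _; rewrite !mxE coef_poly ltn_ord hdotC norm_conjC.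
suff -> : \sum_(n < L) (`|iter n S1 x| ^+ 2 - `|iter n.+1 S1 x| ^+ 2) =
    `|x| ^+ 2 - `|iter L S1 x| ^+ 2 by rewrite gerBl exprn_ge0.
elim: L {c cE1 sL} => [|L IH]; first by rewrite big_ord0 subrr.
by rewrite big_ord_recr IH /= addrA subrK.
Qed.

Variables (p : {poly {poly C}}) (M : C).
Hypothesis M0 : 0 <= M.
Hypothesis pM : forall z lambda, `|z| = 1 -> `|lambda| = 1 ->
  pencil_det s U z lambda = 0 -> `|p.[z%:P].[lambda]| <= M.

Local Notation pT := (poly_op p T1 T2).

Lemma poly_op_bisum x : pT x = bisum p (fun i j => iter i T1 (iter j T2 x)).
Proof. by []. Qed.

Lemma iter_linear (T : {linear H -> H}) k a u v :
  iter k T (a *: u + v) = a *: iter k T u + iter k T v.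
Proof. by elim: k => //= k ->; rewrite linearP. Qed.

Lemma poly_op_linear a u v : pT (a *: u + v) = a *: pT u + pT v.
Proof.
rewrite scaler_sumr -big_split; apply: eq_bigr => i _ /=.
rewrite scaler_sumr -big_split; apply: eq_bigr => j _ /=.
by rewrite !iter_linear scalerDr !scalerA mulrC.
Qed.

Lemma iter_comm k l u : iter k T1 (iter l T2 u) = iter l T2 (iter k T1 u).
Proof.
have c1 l' v : T1 (iter l' T2 v) = iter l' T2 (T1 v).
  by elim: l' => //= l' IH; rewrite T12 IH.
by elim: k => //= k ->; rewrite c1.
Qed.

Lemma poly_op_iter n u : pT (iter n T1 u) = iter n T1 (pT u).
Proof.
rewrite !poly_op_bisum (linear_bisum (L := iter n T1)); last exact: iter_linear.
by apply: eq_bisum => i j _; rewrite -iter_comm -!iterD addnC.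
Qed.

Lemma iter_contraction (T : {linear H -> H}) n u : contraction_op T ->
  `|iter n T u| <= `|u|.
Proof.
move=> Tc; elim: n => //= n; apply: le_trans.
exact: contraction_le.
Qed.

Lemma poly_op_bounded : exists2 K : C, 0 <= K & forall u, `|pT u| <= K * `|u|.
Proof.
exists (\sum_(i < size p) \sum_(j < size p`_i) `|p`_i`_j|).
  by apply: sumr_ge0 => i _; apply: sumr_ge0.
move=> u; rewrite mulr_suml; apply: le_trans (ler_norm_sum _ _ _) _.
apply: ler_sum => i _; rewrite mulr_suml; apply: le_trans (ler_norm_sum _ _ _) _.
apply: ler_sum => j _; rewrite normrZ ler_wpM2l //.
exact: le_trans (iter_contraction _ _ T1c) (iter_contraction _ _ T2c).
Qed.

Lemma poly_op_synth (cs : nat -> 'rV[{poly C}]_m) :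
    (forall i j, (j < size (p`_i)%R)%N -> forall l, (l < j)%N ->
       transfer_step s U (cs l) (cs l.+1)) ->
  pT (synth (cs 0%N)) = synth (poly_act p cs).
Proof.
move=> csS; rewrite /synth /poly_act mulmx_suml pairing_sum.
apply: eq_bigr => i _; rewrite mulmx_suml pairing_sum; apply: eq_bigr => j _.
rewrite -mul_polyC -scalerA -!scalemxAl pairingZ pairingXn; congr (_ *: iter _ _ _).
have := csS i j (ltn_ord j); elim: (j : nat) => //= k IH kS.
rewrite IH => [|l lk]; last by apply: kS; rewrite ltnW.
exact/synth_step/kS.
Qed.

Local Notation transfer_den := (transfer_den s U).

Definition bounded_multiples (D : {poly C}) := forall c, c *m E1 = c ->
  `|pT (synth (D *: c))| ^+ 2 <= M ^+ 2 * row_sq (D *: c).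

(** Each application of the transfer function uses up one factor of the
    denominator, and p(T1, T2) applies T2 a bounded number of times. *)
Lemma transfer_den_bounded : exists k, bounded_multiples (transfer_den ^+ k).
Proof.
pose k := \max_(i < size p) size (p`_i)%R; exists k => c cE1.
(* One power of the denominator is used at each step. *)
pose cs l := transfer_den ^+ (k - l) *: iter l (transfer_num s U) c.
have csS i j : (j < size (p`_i)%R)%N -> forall l, (l < j)%N -> transfer_step s U (cs l) (cs l.+1).
  move=> ji l lj; have lk : (l < k)%N.
    apply: leq_trans lj (leq_trans (ltnW ji) _).
    have [ip|ip] := ltnP i (size p); first exact: (leq_bigmax (Ordinal ip)).
    by rewrite nth_default // size_poly0.
  rewrite /cs -(subnSK lk) exprSr iterS.
  exact: transfer_step_num.
have -> : transfer_den ^+ k *: c = cs 0%N by rewrite /cs subn0.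
have cs0 : cs 0%N *m E1 = cs 0%N by rewrite -scalemxAl cE1.
rewrite (poly_op_synth csS); apply: le_trans (synth_contraction _) _.
have -> : poly_act p cs *m E1 = poly_act p (fun l => cs l *m E1).
  rewrite mulmx_suml; apply: eq_bigr => i _; rewrite mulmx_suml.
  by apply: eq_bigr => j _; rewrite -scalemxAl.
rewrite -cs0; apply: (row_sq_poly_act colligation_unitary nondegU) => [i j ji l lj||//].
- have [w wE ww] := csS i j ji l lj; exists w.
    by rewrite -mulmxA proj_idem.
  by rewrite -ww -mulmxA proj_idem.
- by rewrite -mulmxA proj_idem.
Qed.

Lemma row_sq_eval_le (f : {poly C}) (K : C) c :
    (forall z, `|z| = 1 -> `|f.[z]| <= K) ->
  row_sq (f *: c) <= K ^+ 2 * row_sq c.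
Proof.
move=> fK; apply: row_sq_le => z z1.
rewrite /row_eval map_mxZ /= -/(row_eval z c) dotmxZ ler_wpM2r ?dnorm_ge0 //.
have K0 := le_trans (normr_ge0 _) (fK z z1).
by rewrite lerXn2r ?nnegrE // fK.
Qed.

(** With t = r^-n, the polynomial 1 - t X^n vanishes at [r], so that its
    multiples of [D] are covered by the hypothesis.  It has modulus at most
    1 + |t| on the circle, and 1 - t T1^n is bounded below by 1 - |t|; as |r| > 1,
    t tends to 0. *)
Lemma bounded_multiples_factor D r : 1 < `|r| ->
  bounded_multiples (D * ('X - r%:P)) -> bounded_multiples D.
Proof.
move=> r1 bD c cE1; set d := D *: c.
have r0 : r != 0 by rewrite -normr_gt0 (lt_trans ltr01).
pose Y := `|pT (synth d)| ^+ 2; pose A := M ^+ 2 * row_sq d.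
have A0 : 0 <= A.
  rewrite mulr_ge0 ?exprn_ge0 // sumr_ge0 // => i _.
  by rewrite sumr_ge0 // => n _; rewrite exprn_ge0.
have Y0 : 0 <= Y by rewrite exprn_ge0.
apply: (@ler_small _ Y A (3%:R * A + 2%:R * Y)).
- by apply: addr_ge0; apply: mulr_ge0; rewrite ?ler0n.
- move=> e e0.
  (* The order is partial, so e / (1 + e) stands for the minimum of e and 1. *)
  have e1 : 0 < 1 + e by rewrite addr_gt0.
  have [|n tn] := @small_expVn _ r (e / (1 + e)) r1; first by rewrite divr_gt0.
  pose t := r ^- n; pose f : {poly C} := 1 - t *: 'X^n.
  have t1 : `|t| < 1.
    by apply: lt_trans tn _; rewrite ltr_pdivrMr // mul1r ltrDr.
  have te : `|t| < e.
    by apply: lt_trans tn _; rewrite ltr_pdivrMr // mulrDr mulr1 ltrDl mulr_gt0.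
  have [q fq] : exists q, f = q * ('X - r%:P).
    apply/factor_theorem; rewrite /root /f !hornerE /t.
    by rewrite mulVf ?expf_neq0 // subrr.
  have fK z : `|z| = 1 -> `|f.[z]| <= 1 + `|t|.
    move=> z1; rewrite /f !hornerE (le_trans (ler_normB _ _)) //.
    by rewrite normr1 normrM normrX z1 expr1n mulr1.
  have := bD (q *: c); rewrite -scalemxAl cE1 => /(_ erefl).
  have -> : (D * ('X - r%:P)) *: (q *: c) = f *: d.
    by rewrite fq !scalerA; congr (_ *: _); ring.
  have -> : synth (f *: d) = synth d - t *: iter n T1 (synth d).
    rewrite /synth /f -scalemxAl scalerBl scale1r -mul_polyC -scalerA.
    rewrite -[- _]scaleN1r pairingD.
    have -> : (-1 : {poly C}) = (-1)%:P by rewrite rmorphN rmorph1.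
    by rewrite pairingZ pairingZ pairingXn scaleN1r.
  have -> : pT (synth d - t *: iter n T1 (synth d)) = pT (synth d) - t *: iter n T1 (pT (synth d)).
    by rewrite addrC -scaleNr poly_op_linear poly_op_iter scaleNr addrC.
  set y := pT (synth d) => h1.
  have h2 : `|y - t *: iter n T1 y| ^+ 2 <= (1 + `|t|) ^+ 2 * A.
    apply: le_trans h1 _; rewrite /A mulrCA ler_wpM2l ?exprn_ge0 //.
    exact: row_sq_eval_le.
  have h3 : (1 - `|t|) * `|y| <= `|y - t *: iter n T1 y|.
    rewrite mulrBl mul1r lerBlDr -{1}(subrK (t *: iter n T1 y) y).
    apply: le_trans (ler_normD _ _) _; rewrite lerD2l normrZ ler_wpM2l //.
    exact: iter_contraction.
  have h4 : (1 - `|t|) ^+ 2 * Y <= (1 + `|t|) ^+ 2 * A.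
    apply: le_trans h2; rewrite /Y -exprMn lerXn2r ?nnegrE ?mulr_ge0 //.
    by rewrite subr_ge0 ltW.
  rewrite -subr_ge0.
  have -> : A + (3%:R * A + 2%:R * Y) * e - Y =
     ((1 + `|t|) ^+ 2 * A - (1 - `|t|) ^+ 2 * Y) +
     (3%:R * A + 2%:R * Y) * (e - `|t|) + `|t| * (1 - `|t|) * A + `|t| ^+ 2 * Y by ring.
  (* The slack of the squared inequality, written as a sum of nonnegative terms. *)
  have AY0 : 0 <= 3%:R * A + 2%:R * Y.
    by apply: addr_ge0; apply: mulr_ge0; rewrite ?ler0n.
  have et0 : 0 <= e - `|t| by rewrite subr_ge0 ltW.
  have t10 : 0 <= 1 - `|t| by rewrite subr_ge0 ltW.
  apply: addr_ge0; last by apply: mulr_ge0 => //; exact: exprn_ge0.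
  apply: addr_ge0; last by apply: mulr_ge0 => //; exact: mulr_ge0.
  by apply: addr_ge0; [rewrite subr_ge0 | exact: mulr_ge0].
- exact: ger0_real.
Qed.

Lemma poly_op_synth_bound c : c *m E1 = c ->
  `|pT (synth c)| ^+ 2 <= M ^+ 2 * row_sq c.
Proof.
have [k] := transfer_den_bounded.
have roots z : root (transfer_den ^+ k) z -> 1 < `|z|.
  rewrite rootE horner_exp expf_eq0 => /andP[_ dz].
  rewrite real_ltNge ?normr_real ?real1 //; apply/negP => z1.
  by move: dz; rewrite (negbTE (transfer_den_neq0 colligation_unitary nondegU z1)).
have d0 : transfer_den ^+ k != 0.
  rewrite expf_neq0 //; apply/eqP => d0.
  have := @transfer_den_neq0 _ _ s U colligation_unitary nondegU 0.
  by rewrite normr0 d0 horner0 eqxx => /(_ ler01).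
have [rs rsE] := closed_field_poly_normal (transfer_den ^+ k).
have rs1 z : z \in rs -> 1 < `|z|.
  move=> zr; apply: roots; rewrite rsE rootZ ?lead_coef_eq0 //.
  by rewrite root_prod_XsubC.
rewrite rsE; set l := lead_coef _ => bnd.
have l0 : l != 0 by rewrite lead_coef_eq0.
have {}bnd : bounded_multiples (\prod_(z <- rs) ('X - z%:P)).
  move=> c' c'E1; have := bnd (l^-1%:P *: c'); rewrite -scalemxAl c'E1 => /(_ erefl).
  by rewrite -mul_polyC scalerA mulrAC -polyCM mulfV // mul1r.
have {bnd} bnd1 : bounded_multiples 1.
  elim: rs rs1 bnd {rsE} => [|z rs IH] rs1; first by rewrite big_nil.
  rewrite big_cons mulrC => bnd; apply: IH => [x xrs|].
    by apply: rs1; rewrite inE xrs orbT.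
  by apply: bounded_multiples_factor bnd; apply: rs1; rewrite inE eqxx.
by move=> cE1; have := bnd1 c cE1; rewrite scale1r.
Qed.

(** By purity of [T1], x is the limit of vectors [synth c] with l2 norm of [c] at
    most |x|. *)
Lemma poly_op_norm_le : is_pure dot T1 -> forall x, `|pT x| <= M * `|x|.
Proof.
move=> T1p x; have [K K0 KP] := poly_op_bounded.
apply: (@ler_small _ _ _ K) => // [e e0|]; last first.
  by rewrite ger0_real ?mulr_ge0.
have [L LP] := pure_small x T1p e0.
have [c [cE1 cs cx]] := synth_approx x L.
have -> : pT x = pT (synth c) + pT (iter L T1 (iter L S1 x)).
  by rewrite -[pT (synth c)]scale1r -poly_op_linear scale1r cs subrK.
apply: le_trans (ler_normD _ _) _; apply: lerD.
  rewrite -(@ler_pXn2r _ 2) ?nnegrE ?mulr_ge0 // exprMn.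
  apply: le_trans (poly_op_synth_bound cE1) _.
  by rewrite ler_wpM2l ?exprn_ge0.
apply: le_trans (KP _) _; rewrite ler_wpM2l //.
by apply: le_trans (iter_contraction _ _ T1c) (ltW (LP L _)).
Qed.

End VonNeumann.

(** * Zeros of the pencil determinant *)
Section PencilZeros.
Variables (C : numClosedFieldType) (m : nat) (s : pred 'I_m) (U : 'M[C]_m).
Hypothesis unitU : U \is unitarymx.
Hypothesis nondegU : no_unimodular_eigenvector (predC s) U.
Local Notation E1 := (proj s).
Local Notation E2 := (proj (predC s)).
Implicit Types (x y v : 'rV[C]_m) (z : C).

Lemma proj_eq0 x : x *m E1 = 0 -> x *m E2 = x.
Proof. by move=> x1; rewrite [RHS](mulmx_projDC x s) x1 add0r. Qed.

Lemma projC_eq0 x : x *m E2 = 0 -> x *m E1 = x.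
Proof. by move=> x2; rewrite [RHS](mulmx_projDC x s) x2 addr0. Qed.

Lemma scaled_eigen_inv z x y : `|z| = 1 -> z *: x = y -> x = z^-1 *: y.
Proof.
move=> z1 <-; rewrite scalerA mulVf ?scale1r //.
by rewrite -normr_eq0 z1 oner_eq0.
Qed.

(** For |z1| < 1 <= |z2| the two sides of the norm identity have opposite
    signs; both vanish, and the null row is a unimodular eigenvector in the first
    class. *)
Lemma pencil_det_inside z1 z2 : no_unimodular_eigenvector s U ->
  pencil_det s U z1 z2 = 0 -> `|z1| < 1 -> `|z2| < 1.
Proof.
move=> nondeg1 /eqP/pencil_detP[x x0 xE] z1lt.
rewrite real_ltNge ?normr_real ?real1 //; apply/negP => z2ge.
have e := pencil_det_norm unitU xE.
have d1 : 0 < 1 - `|z1| ^+ 2 by rewrite subr_gt0 exprn_ilt1.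
have d2 : 1 - `|z2| ^+ 2 <= 0 by rewrite subr_le0 exprn_ege1.
have b0 : '[x *m E2] = 0.
  apply/eqP; rewrite eq_le dnorm_ge0 andbT -(pmulr_rle0 _ d1) -e.
  by rewrite mulr_le0_ge0 // dnorm_ge0.
have xE1 : x *m E1 = x.
  by apply: projC_eq0; have /eqP := b0; rewrite dnorm_eq0 => /eqP.
have z2n : `|z2| = 1.
  move: e; rewrite b0 mulr0 xE1 => /eqP; rewrite mulf_eq0 dnorm_eq0 (negbTE x0) orbF.
  rewrite subr_eq0 eq_sym sqrp_eq1 // => /eqP //.
move: xE; rewrite xE1 (mulmx_projC0 xE1) scaler0 !addr0 => xU.
by move/eqP: x0; apply; apply: nondeg1 z2n xE1 xU.
Qed.

(** For |z1| = 1 the norm identity leaves |z2| = 1, or x E1 = 0: a null row in the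
    second class, where it is a unimodular eigenvector. *)
Lemma pencil_det_distinguished z1 z2 :
  pencil_det s U z1 z2 = 0 -> `|z1| = 1 -> `|z2| <= 1 -> `|z2| = 1.
Proof.
move=> /eqP/pencil_detP[x x0 xE] z1n z2le.
have e := pencil_det_norm unitU xE.
apply/eqP; rewrite eq_le z2le /= real_leNgt ?normr_real ?real1 //; apply/negP => z2lt.
have a0 : x *m E1 = 0.
  move: e; rewrite z1n expr1n subrr mul0r => /eqP; rewrite mulf_eq0 dnorm_eq0.
  rewrite gt_eqF /= => [/eqP //|]; by rewrite subr_gt0 exprn_ilt1.
have xE2 := proj_eq0 a0.
move: xE; rewrite a0 scaler0 !add0r xE2 -scalemxAl => /(scaled_eigen_inv z1n) xU.
move/eqP: x0; apply; apply: (nondegU _ xE2 xU).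
by rewrite normfV z1n invr1.
Qed.

Lemma pencil_det_transfer z lambda : `|z| = 1 -> pencil_det s U z lambda = 0 ->
  exists2 c : 'rV[C]_m, c != 0 & c *m transfer s U z = lambda *: c.
Proof.
move=> z1 /eqP/pencil_detP[x x0 xE]; exists (x *m E1).
  apply: contra_neq x0 => a0; have xE2 := proj_eq0 a0.
  move: xE; rewrite a0 scaler0 !add0r xE2 -scalemxAl => /(scaled_eigen_inv z1) xU.
  by apply: (nondegU _ xE2 xU); rewrite normfV z1 invr1.
have z1le : `|z| <= 1 by rewrite z1.
set c := x *m E1; pose w := lambda *: c + x *m E2.
have cE1 : c *m E1 = c by rewrite -mulmxA proj_idem.
have w1 : w *m E1 = lambda *: c.
  by rewrite mulmxDl -scalemxAl cE1 -mulmxA projC_proj mulmx0 addr0.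
have w2 : w *m E2 = x *m E2.
  by rewrite mulmxDl -scalemxAl (mulmx_projC0 cE1) scaler0 add0r -mulmxA proj_idem.
by rewrite -w1; apply/esym/transfer_state => //; rewrite w2 cE1.
Qed.

Lemma pencil_det_torus_exists k : s k ->
  exists lambda, `|lambda| = 1 /\ pencil_det s U 1 lambda = 0.
Proof.
move=> sk; have n1 : `|1 : C| = 1 by exact: normr1.
have Gu := transfer_completion_unitary unitU nondegU n1.
set F := transfer s U 1 in Gu; set G := F + E2 in Gu.
have GE1 : G *m E1 = F by exact: transfer_completion_proj.
have E1G : E1 *m G = F by exact: proj_transfer_completion.
have [P Pu [D PG]] := unitary_eigenbasis Gu.
have /existsP[i vi] : [exists i, row i P *m E1 != 0].
  apply: contraT; rewrite negb_exists => /forallP h.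
  have PE0 : P *m E1 = 0.
    apply/row_matrixP => i; rewrite row_mul row0; apply/eqP.
    by have := h i; rewrite negbK.
  have : E1 = 0 :> 'M[C]_m by rewrite -[E1]mul1mx -(mulVmx_unitary Pu) -mulmxA PE0 mulmx0.
  by move=> /matrixP/(_ k k); rewrite !mxE eqxx sk => /eqP; rewrite oner_eq0.
set v := row i P *m E1 in vi.
have vE1 : v *m E1 = v by rewrite -mulmxA proj_idem.
have vF : v *m F = D i *: v.
  by rewrite -E1G mulmxA vE1 /v -mulmxA E1G -GE1 mulmxA PG scalemxAl.
have vG : v *m G = D i *: v by rewrite /v -mulmxA E1G -GE1 mulmxA PG scalemxAl.
exists (D i); split; first exact: unitary_eigenvalue Gu vi vG.
by apply: (pencil_det_eigen unitU nondegU _ vi vE1 vF); rewrite n1.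
Qed.

End PencilZeros.

Section Approximation.
Variables (R : realType) (m : nat) (s : pred 'I_m) (U : 'M[R[i]]_m).
Local Notation C := R[i].
Hypothesis unitU : U \is unitarymx.
Hypothesis nondegU : no_unimodular_eigenvector (predC s) U.
Local Notation E1 := (proj s).
Local Notation E2 := (proj (predC s)).
Local Notation UP := (map_mx (@polyC C) U).

Lemma horner_bounded (f : {poly C}) : exists2 K : C, 0 <= K &
  forall z, `|z| <= 1 -> `|f.[z]| <= K.
Proof.
exists (\sum_(i < size f) `|f`_i|); first exact: sumr_ge0.
move=> z z1; rewrite horner_coef (le_trans (ler_norm_sum _ _ _)) //.
apply: ler_sum => i _; rewrite normrM normrX ler_piMr //.
exact: exprn_ile1.
Qed.

Lemma horner_lipschitz (f : {poly C}) a : exists2 K : C, 0 <= K &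
  forall z, `|z| <= 1 -> `|f.[z] - f.[a]| <= K * `|z - a|.
Proof.
have /factor_theorem[q fq] : root (f - f.[a]%:P) a by rewrite rootE !hornerE subrr.
have [K K0 KP] := horner_bounded q; exists K => // z z1.
have -> : f.[z] - f.[a] = q.[z] * (z - a).
  by have := congr1 (horner^~ z) fq; rewrite !hornerE.
by rewrite normrM ler_wpM2r // KP.
Qed.

(** Cramer's rule for the inverse in the transfer function. *)
Lemma transfer_den_num z : `|z| <= 1 -> (transfer_den s U).[z] *: transfer s U z =
  map_mx (horner_eval z) (E1 *m UP *m \adj (state_mxX s U) *m E1).
Proof.
move=> z1; have Qu := state_mx_unit unitU nondegU z1.
rewrite !map_mxM !map_proj map_mx_adj map_state_mxX transfer_den_eval /transfer.
have -> : map_mx (horner_eval z) UP = U.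
  by apply/matrixP => i j; rewrite !mxE /= /horner_eval hornerC.
rewrite /invmx Qu -!(scalemxAl, scalemxAr) scalerA mulfV ?scale1r //.
Qed.

Lemma normr_prod_ge_exp (rs : seq C) a e : 0 <= e ->
    (forall x, x \in rs -> e <= `|a - x|) ->
  e ^+ size rs <= `|(\prod_(x <- rs) ('X - x%:P)).[a]|.
Proof.
move=> e0; elim: rs => [|x rs IH] ers; first by rewrite big_nil hornerC normr1.
rewrite big_cons hornerM normrM exprS !hornerE ler_pM ?exprn_ge0 //.
  by apply: ers; rewrite inE eqxx.
by apply: IH => y yr; apply: ers; rewrite inE yr orbT.
Qed.

(** Continuity of roots.  Let z tend to [w] along the radius.  The
    characteristic polynomial of F(z) is monic of degree [m], and its value at
    [lambda] is the product of the distances from [lambda] to the eigenvalues; it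
    tends to 0, so some eigenvalue is close to [lambda].  An eigenvalue close
    to the circle is not 0, hence its eigenvector is in the range of E1. *)
Lemma pencil_det_approx w lambda e : `|w| = 1 -> `|lambda| = 1 ->
    pencil_det s U w lambda = 0 -> 0 < e ->
  exists z1 z2, [/\ `|z1| < 1, pencil_det s U z1 z2 = 0,
    `|w - z1| < e & `|lambda - z2| < e].
Proof.
move=> w1 l1 wl0 e0.
(* A tolerance below 1 keeps z2 away from 0. *)
wlog e1 : e e0 / e < 1.
  move=> IH; have [||z1 [z2 [z1lt z2E d1 d2]]] := IH (e / (1 + e)).
  - by rewrite divr_gt0 // addr_gt0.
  - by rewrite ltr_pdivrMr ?addr_gt0 // mul1r ltrDr.
  have le : e / (1 + e) < e.
    by rewrite ltr_pdivrMr ?addr_gt0 // mulrDr mulr1 ltrDl mulr_gt0.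
  by exists z1, z2; split=> //; apply: lt_trans le.
have [c c0 cE] := pencil_det_transfer unitU nondegU w1 wl0.
have wle : `|w| <= 1 by rewrite w1.
pose Psi := E1 *m UP *m \adj (state_mxX s U) *m E1.
(* f(z) is the value at lambda of the characteristic polynomial of F(z), times the
   power of the denominator that makes it a polynomial in z. *)
pose f := \det ((lambda%:P * transfer_den s U)%:M - Psi).
have fE z : `|z| <= 1 ->
    f.[z] = (transfer_den s U).[z] ^+ m * (char_poly (transfer s U z)).[lambda].
  move=> z1; transitivity (\det (map_mx (horner_eval z) ((lambda%:P * transfer_den s U)%:M - Psi))).
    exact: esym (det_map_mx (horner_eval z) _).
  rewrite map_mxB -(transfer_den_num z1).
  have -> : map_mx (horner_eval z) ((lambda%:P * transfer_den s U)%:M : 'M_m) =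
     (transfer_den s U).[z] *: lambda%:M.
    apply/matrixP => i j; rewrite !mxE /= /horner_eval hornerMn hornerM hornerC.
    by rewrite mulrnAr mulrC.
  rewrite -scalerBr detZ; congr (_ * _).
  rewrite -[RHS]/(horner_eval lambda _) -det_map_mx; congr (\det _).
  apply/matrixP => i j; rewrite !mxE /= /horner_eval !hornerE hornerMn hornerX.
  by [].
have fw0 : f.[w] = 0.
  rewrite fE // [X in _ * X](_ : _ = 0) ?mulr0 //; apply/eqP.
  rewrite -rootE -eigenvalue_root_char; apply/eigenvalueP.
  by exists c.
have [K K0 KP] := horner_lipschitz f w.
have [K2 K20 K2P] := horner_lipschitz (transfer_den s U) w.
have D0 : 0 < `|(transfer_den s U).[w]|.
  by rewrite normr_gt0; apply: transfer_den_neq0.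
set D := `|(transfer_den s U).[w]| in D0.
have [N1 N1P] := small_invn e0.
have [|N2 N2P] := @small_invn _ (D / 2%:R / (1 + K2)).
  by rewrite !divr_gt0 // ltr_wpDr.
have [|N3 N3P] := @small_invn _ (e ^+ m * (D / 2%:R) ^+ m / (1 + K)).
  by rewrite divr_gt0 ?mulr_gt0 ?exprn_gt0 ?divr_gt0 // ltr_wpDr.
pose n := maxn N1 (maxn N2 N3).
pose t : C := n.+1%:R^-1.
have tP1 : t < e by apply: N1P; rewrite leq_maxl.
have tP2 : t * (1 + K2) < D / 2%:R.
  rewrite -ltr_pdivlMr ?ltr_wpDr //; apply: N2P.
  by rewrite /n !leq_max leqnn orbT.
have tP3 : t * (1 + K) < e ^+ m * (D / 2%:R) ^+ m.
  rewrite -ltr_pdivlMr ?ltr_wpDr //; apply: N3P.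
  by rewrite /n !leq_max leqnn !orbT.
have t0 : 0 < t by rewrite invr_gt0 ltr0n.
have t1 : t <= 1 by rewrite invf_le1 ?ltr0n // ler1n.
(* Three smallness conditions on t: z is close to w, the denominator at z is
   at least half its value at w, and f(z) is small against e^m. *)
pose z := (1 - t) * w.
have nz : `|z| = 1 - t by rewrite normrM w1 mulr1 ger0_norm // subr_ge0.
have zlt : `|z| < 1 by rewrite nz gtrBl.
have zw : `|z - w| = t.
  have -> : z - w = - (t * w) by rewrite /z; ring.
  by rewrite normrN normrM w1 mulr1 gtr0_norm.
have zle := ltW zlt.
have fz : `|f.[z]| < e ^+ m * (D / 2%:R) ^+ m.
  have := KP z zle; rewrite fw0 subr0 zw => /le_lt_trans; apply.
  by apply: le_lt_trans tP3; rewrite mulrC ler_wpM2l ?(ltW t0) // lerDr.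
have Dz : D / 2%:R <= `|(transfer_den s U).[z]|.
  have := K2P z zle; rewrite zw => h.
  have h2 : `|(transfer_den s U).[z] - (transfer_den s U).[w]| <= D / 2%:R.
    apply: le_trans h (ltW (le_lt_trans _ tP2)).
    by rewrite mulrC ler_wpM2l ?(ltW t0) // lerDr.
  have : D <= `|(transfer_den s U).[z]| + `|(transfer_den s U).[z] - (transfer_den s U).[w]|.
    rewrite addrC distrC /D -{1}(subrK (transfer_den s U).[z] (transfer_den s U).[w]).
    exact: ler_normD.
  move=> /le_trans /(_ (lerD (lexx _) h2)); rewrite -lerBlDr.
  by have -> : D - D / 2%:R = D / 2%:R by field.
have charz : `|(char_poly (transfer s U z)).[lambda]| < e ^+ m.
  have D2 : 0 < D / 2%:R by rewrite divr_gt0.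
  rewrite -(ltr_pM2r (exprn_gt0 m D2)); apply: le_lt_trans fz.
  rewrite (fE z zle) normrM normrX mulrC ler_wpM2r // lerXn2r ?nnegrE //.
  exact: ltW.
have [rs rsE] := closed_field_poly_normal (char_poly (transfer s U z)).
rewrite (monicP (char_poly_monic _)) scale1r in rsE.
have szrs : size rs = m.
  by apply/eqP; rewrite -eqSS -(size_prod_XsubC rs id) -rsE size_char_poly.
have [z2 z2r z2e] : exists2 z2, z2 \in rs & `|lambda - z2| < e.
  apply/hasP; apply: contraT => /hasPn h; move: charz; rewrite rsE.
  rewrite -szrs => /lt_geF; rewrite normr_prod_ge_exp ?(ltW e0) // => x xr.
  by rewrite real_leNgt ?normr_real ?ger0_real ?(ltW e0) // h.
exists z, z2; split; [exact: zlt | | by rewrite distrC zw | exact: z2e].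
have z20 : z2 != 0.
  apply: contraTneq z2e => ->; rewrite subr0 l1 real_ltNge ?gtr0_real ?real1 //.
  by rewrite negbK ltW.
have /eigenvalueP[v vE v0] : eigenvalue (transfer s U z) z2.
  by rewrite eigenvalue_root_char rsE root_prod_XsubC.
apply: (pencil_det_eigen unitU nondegU zle v0 _ vE).
have : (z2 *: v) *m E1 = z2 *: v by rewrite -vE -mulmxA transfer_proj.
by rewrite -scalemxAl => /(scalerI z20).
Qed.

End Approximation.

(** * The varieties, and the theorem *)
Section Norms.
Variable R : realType.
Local Notation C := R[i].
Implicit Types (p q : {poly {poly C}}) (V : set (C^o * C^o)).

Definition coef_norm p : C := \sum_(i < size p) \sum_(j < size p`_i) `|p`_i`_j|.

Lemma horner2_norm_le p (x y : C) : `|x| <= 1 -> `|y| <= 1 ->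
  `|p.[x%:P].[y]| <= coef_norm p.
Proof.
move=> x1 y1; rewrite horner2_bisum (le_trans (ler_norm_sum _ _ _)) //.
apply: ler_sum => i _; rewrite (le_trans (ler_norm_sum _ _ _)) //.
apply: ler_sum => j _; rewrite !normrM !normrX ler_piMr //.
by rewrite mulr_ile1 ?exprn_ge0 ?exprn_ile1.
Qed.

Lemma norm_on_ubound p V : V `<=` @closed_bidisc R ->
  has_ubound [set complex.Re `|p.[z.1%:P].[z.2]| | z in V].
Proof.
move=> VD; exists (complex.Re (coef_norm p)) => _ [z /VD[z1 z2] <-].
exact: (@ler_Re _ `|p.[z.1%:P].[z.2]|  _ (horner2_norm_le _ z1 z2)).
Qed.

Lemma norm_on_ge0 p V : 0 <= norm_on p V.
Proof.
rewrite /norm_on; set A := (X in sup X).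
have [[[a Aa] ubA]|] := pselect (has_sup A); last by move/sup_out => ->.
apply: le_trans (ub_le_sup ubA Aa); case: Aa => z _ <-.
exact: (@ler_Re _ 0 `|p.[z.1%:P].[z.2]|).
Qed.

Lemma le_norm_on p V z : V `<=` @closed_bidisc R -> V z ->
  `|p.[z.1%:P].[z.2]| <= (norm_on p V)%:C%C.
Proof.
move=> VD Vz; rewrite [leLHS]ge0_ReE // lecR.
by apply: ub_le_sup; [exact: norm_on_ubound | exists z].
Qed.

Lemma opnorm_le (H : completeNormedModType C) (T : H -> H) (M : R) : 0 <= M ->
  (forall x, `|T x| <= M%:C%C * `|x|) -> opnorm T <= M.
Proof.
move=> M0 TM; apply: ge_sup.
  by exists (complex.Re `|T 0|), 0 => //=; rewrite normr0.
move=> _ [x /= x1 <-].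
apply: (@ler_Re _ `|T x| M%:C%C); apply: le_trans (TM x) _.
by rewrite ler_piMr // ler0c.
Qed.

Lemma expr_lipschitz (x a : C) i : `|x| <= 1 -> `|a| <= 1 ->
  `|x ^+ i - a ^+ i| <= i%:R * `|x - a|.
Proof.
move=> x1 a1; elim: i => [|i IH]; first by rewrite subrr normr0 mul0r.
have -> : x ^+ i.+1 - a ^+ i.+1 = x * (x ^+ i - a ^+ i) + (x - a) * a ^+ i.
  by rewrite !exprS; ring.
apply: le_trans (ler_normD _ _) _; rewrite -natr1 [leRHS]mulrDl mul1r lerD //.
  by rewrite normrM (le_trans _ IH) // ler_piMl.
by rewrite normrM normrX ler_piMr // exprn_ile1.
Qed.

(** The Lipschitz form serves both the bound by continuity and the fact that
    zeros persist in the closure. *)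
Lemma horner2_lipschitz p : exists2 L : C, 0 <= L & forall (x y a b e : C),
  `|x| <= 1 -> `|y| <= 1 -> `|a| <= 1 -> `|b| <= 1 -> `|x - a| <= e -> `|y - b| <= e ->
  `|p.[x%:P].[y] - p.[a%:P].[b]| <= L * e.
Proof.
exists (\sum_(i < size p) \sum_(j < size p`_i) `|p`_i`_j| * (i%:R + j%:R)).
  by apply: sumr_ge0 => i _; apply: sumr_ge0 => j _; rewrite mulr_ge0 ?addr_ge0.
move=> x y a b e x1 y1 a1 b1 xa yb; have e0 := le_trans (normr_ge0 _) xa.
rewrite !horner2_bisum -sumrB mulr_suml (le_trans (ler_norm_sum _ _ _)) //.
apply: ler_sum => i _; rewrite -sumrB mulr_suml (le_trans (ler_norm_sum _ _ _)) //.
apply: ler_sum => j _; rewrite /GRing.scale /= -mulrBr normrM -mulrA ler_wpM2l //.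
have -> : x ^+ i * y ^+ j - a ^+ i * b ^+ j =
  (x ^+ i - a ^+ i) * y ^+ j + a ^+ i * (y ^+ j - b ^+ j) by ring.
apply: le_trans (ler_normD _ _) _; rewrite [leRHS]mulrDl lerD // normrM.
  apply: le_trans (_ : `|x ^+ i - a ^+ i| <= _).
    by rewrite ler_piMr // normrX exprn_ile1.
  by apply: le_trans (expr_lipschitz _ x1 a1) _; rewrite ler_wpM2l.
apply: le_trans (_ : `|y ^+ j - b ^+ j| <= _).
  by rewrite ler_piMl // normrX exprn_ile1.
by apply: le_trans (expr_lipschitz _ y1 b1) _; rewrite ler_wpM2l.
Qed.

Lemma closure_approx V (z : C^o * C^o) e : closure V z -> 0 < e ->
  exists2 v, V v & `|z.1 - v.1| < e /\ `|z.2 - v.2| < e.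
Proof.
move=> clV e0; have [v [Vv [b1 b2]]] := clV _ (nbhsx_ballx z e e0).
by exists v => //; move: b1 b2; rewrite -!ball_normE.
Qed.

Lemma disc_interior (z : C^o) : disc z -> interior (@disc R) z.
Proof.
move=> z1; apply/nbhs_ballP; exists (1 - `|z|) => /=; first by rewrite subr_gt0.
move=> y; rewrite -ball_normE /= /disc /= distrC => d.
rewrite -(subrK z y) (le_lt_trans (ler_normD _ _)) //.
by rewrite -ltrBrDr.
Qed.

Lemma bidisc_interior z : @bidisc R z -> interior (@bidisc R) z.
Proof.
move=> [z1 z2]; exists (@disc R, @disc R) => //=.
by split; exact: disc_interior.
Qed.

Lemma closure_bidisc_sub V z : V `<=` @bidisc R -> closure V z -> @closed_bidisc R z.
Proof.
move=> VD clV; have ap e : 0 < e -> `|z.1| <= 1 + e /\ `|z.2| <= 1 + e.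
  move=> e0; have [v /VD[v1 v2] [d1 d2]] := closure_approx clV e0.
  split; [rewrite -(subrK v.1 z.1) | rewrite -(subrK v.2 z.2)];
    by rewrite (le_trans (ler_normD _ _)) // addrC lerD // ltW.
by split; apply: (@ler_small _ _ 1 1) => // e /ap[]; rewrite mul1r.
Qed.

Lemma closure_zero q V z : V `<=` @bidisc R ->
  (forall v, V v -> q.[v.1%:P].[v.2] = 0) -> closure V z -> q.[z.1%:P].[z.2] = 0.
Proof.
move=> VD Vq clV; have [z1 z2] := closure_bidisc_sub VD clV.
have [L L0 LP] := horner2_lipschitz q.
apply/eqP; rewrite -normr_le0; apply: (@ler_small _ _ 0 L) => // e e0; rewrite add0r.
have [v Vv [d1 d2]] := closure_approx clV e0; have [v1 v2] := VD _ Vv.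
rewrite -[q.[_].[_]]subr0 -(Vq v Vv).
by apply: LP => //; apply: ltW.
Qed.

(** A point of the closure is a zero in the closed bidisc.  If it is on the
    boundary its coordinates are not both in the open disc, and the two hypotheses
    put both on the unit circle. *)
Lemma distinguished_variety_of_zeros q V : V !=set0 ->
    V = [set z | bidisc z /\ q.[z.1%:P].[z.2] = 0] ->
    (forall z1 z2 : C, q.[z1%:P].[z2] = 0 -> `|z1| < 1 -> `|z2| < 1) ->
    (forall z1 z2 : C, q.[z1%:P].[z2] = 0 -> `|z1| = 1 -> `|z2| <= 1 -> `|z2| = 1) ->
  distinguished_variety V.
Proof.
move=> V0 VE inside edge; have VD : V `<=` @bidisc R by rewrite VE => z [].
split=> //; first by exists q.
have Vq v : V v -> q.[v.1%:P].[v.2] = 0 by rewrite VE => -[].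
have not_int (z : C^o) : `|z| = 1 -> ~ interior (@disc R) z.
  by move=> z1 /interior_subset; rewrite /disc /= z1 ltxx.
apply/seteqP; split=> z [clz] /=.
- move=> [clD nint]; split=> //; have [z1 z2] := closure_bidisc_sub VD clz.
  have z0 := closure_zero VD Vq clz.
  have n1 : `|z.1| = 1.
    apply/eqP; rewrite eq_le z1 /= real_leNgt ?normr_real ?real1 //; apply/negP => lt1.
    by apply: nint; apply: bidisc_interior; split=> //; apply: inside lt1.
  have n2 := edge _ _ z0 n1 z2.
  have cl1 : closure (@disc R) z.1.
    move=> B /nbhs_ballP[e /= e0 Be]; have [v /VD[v1 v2] [d1 d2]] := closure_approx clz e0.
    by exists v.1; split=> //; apply: Be; rewrite -ball_normE.
  have cl2 : closure (@disc R) z.2.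
    move=> B /nbhs_ballP[e /= e0 Be]; have [v /VD[v1 v2] [d1 d2]] := closure_approx clz e0.
    by exists v.2; split=> //; apply: Be; rewrite -ball_normE.
  split; split; [exact: cl1 | exact: not_int n1 | exact: cl2 | exact: not_int n2].
- move=> [[cl1 ni1] [cl2 ni2]]; split=> //; split.
    by apply: closure_subset clz.
  by move=> /interior_subset[z1 _]; apply: ni1; apply: disc_interior.
Qed.

End Norms.

Section PencilVarieties.
Variables (R : realType) (m : nat) (s : pred 'I_m) (U : 'M[R[i]]_m).
Local Notation C := R[i].
Hypothesis unitU : U \is unitarymx.
Hypothesis nondegU : no_unimodular_eigenvector (predC s) U.
Local Notation q := (pencil_poly s U).

Definition pencil_variety : set (C^o * C^o) :=
  [set z | closed_bidisc z /\ q.[z.1%:P].[z.2] = 0].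

Definition open_pencil_variety : set (C^o * C^o) :=
  [set z | bidisc z /\ q.[z.1%:P].[z.2] = 0].

Lemma pencil_variety_bound p (z lambda : C) :
    `|z| = 1 -> `|lambda| = 1 -> pencil_det s U z lambda = 0 ->
  `|p.[z%:P].[lambda]| <= (norm_on p pencil_variety)%:C%C.
Proof.
move=> z1 l1 zl; apply: (@le_norm_on _ p pencil_variety (z, lambda)).
  by move=> ? [].
split; last by rewrite pencil_polyE.
by split; rewrite /closed_disc /= ?z1 ?l1.
Qed.

Hypothesis nondegU1 : no_unimodular_eigenvector s U.

Lemma open_pencil_approx (z lambda e : C) :
    `|z| = 1 -> `|lambda| = 1 -> pencil_det s U z lambda = 0 -> 0 < e ->
  exists2 v, open_pencil_variety v & `|z - v.1| <= e /\ `|lambda - v.2| <= e.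
Proof.
move=> z1 l1 zl e0.
have [a [b [a1 ab0 za lb]]] := pencil_det_approx unitU nondegU z1 l1 zl e0.
exists (a, b); last by split; apply: ltW.
split; last by rewrite pencil_polyE.
by have b1 : `|b| < 1 := pencil_det_inside unitU nondegU1 ab0 a1.
Qed.

(** A zero on the torus is a limit of points of the variety, and |p| is
    continuous. *)
Lemma open_pencil_variety_bound p (z lambda : C) :
    `|z| = 1 -> `|lambda| = 1 -> pencil_det s U z lambda = 0 ->
  `|p.[z%:P].[lambda]| <= (norm_on p open_pencil_variety)%:C%C.
Proof.
move=> z1 l1 zl; have [L L0 LP] := horner2_lipschitz p.
have M0 : 0 <= (norm_on p open_pencil_variety)%:C%C by rewrite ler0c norm_on_ge0.
apply: (ler_small L0) => [e e0|]; last exact: ger0_real.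
have [v Vv [d1 d2]] := open_pencil_approx z1 l1 zl e0.
have [[v1 v2] _] := Vv.
rewrite -(subrK p.[v.1%:P].[v.2] p.[z%:P].[lambda]).
apply: le_trans (ler_normD _ _) _; rewrite addrC; apply: lerD.
  by apply: le_norm_on => // w [[w1 w2] _]; split; apply: ltW.
by apply: LP => //; rewrite ?z1 ?l1 //; apply: ltW.
Qed.

Lemma open_pencil_variety_distinguished k : s k ->
  distinguished_variety open_pencil_variety.
Proof.
move=> sk; apply: distinguished_variety_of_zeros (erefl _) _ _.
- have [lambda [l1 zl]] := pencil_det_torus_exists unitU nondegU sk.
  have [v Vv _] := open_pencil_approx (normr1 _) l1 zl ltr01.
  by exists v.
- by move=> z1 z2; rewrite pencil_polyE; exact: pencil_det_inside.
- by move=> z1 z2; rewrite pencil_polyE; exact: pencil_det_distinguished.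
Qed.

End PencilVarieties.

(** The diagonal, as the variety of the exchange matrix of size two, whose
    transfer function is z. *)
Lemma distinguished_variety_exists (R : realType) :
  exists V : set (R[i]^o * R[i]^o), distinguished_variety V.
Proof.
pose U : 'M[R[i]]_2 := \matrix_(i, j) (i != j)%:R.
have U0 (v : 'rV[R[i]]_2) : (v *m U) 0 0 = v 0 1.
  rewrite mxE !big_ord_recl big_ord0 !mxE /= mulr0 mulr1 add0r addr0.
  by congr (v _ _); apply: val_inj.
have U1 (v : 'rV[R[i]]_2) : (v *m U) 0 1 = v 0 0.
  by rewrite mxE !big_ord_recl big_ord0 !mxE /= mulr0 mulr1 !addr0.
have unitU : U \is unitarymx.
  apply: isometry_unitary => v; rewrite !dotmxx_sum !big_ord_recl !big_ord0 !addr0.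
  have -> : lift ord0 ord0 = 1 :> 'I_2 by apply: val_inj.
  by rewrite U0 U1 addrC.
pose s : pred 'I_2 := fun i => i == 0.
(* Each class has one coordinate, and U exchanges the two. *)
have row2 (v : 'rV[R[i]]_2) : v 0 0 = 0 -> v 0 1 = 0 -> v = 0.
  move=> v0 v1; apply/rowP => -[[|[|//]] ?]; rewrite mxE.
    by rewrite -[RHS]v0; congr (v _ _); apply: val_inj.
  by rewrite -[RHS]v1; congr (v _ _); apply: val_inj.
exists (open_pencil_variety s U).
apply: (@open_pencil_variety_distinguished _ _ _ _ unitU _ _ 0) => //.
- move=> mu v _ /rowP vs /rowP vU; have v0 : v 0 0 = 0.
    by rewrite -vs mulmx_projE.
  by apply: row2 => //; have := vU 0; rewrite U0 mxE v0 mulr0.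
- move=> mu v _ /rowP vs /rowP vU; have v1 : v 0 1 = 0.
    by rewrite -vs mulmx_projE.
  by apply: row2 => //; have := vU 1; rewrite U1 mxE v1 mulr0.
Qed.

Theorem theorem4p3 (R : realType) (H : completeNormedModType R[i])
    (dot : {dot H for (@Num.conj R[i])}) (dotE : hilbert_dot dot)
    (T1 T2 : {linear H -> H})
    (T1_contr : contraction_op T1) (T2_contr : contraction_op T2)
    (T12_comm : forall h : H, T1 (T2 h) = T2 (T1 h))
    (T1_pure : is_pure dot T1)
    (T1_defect : finite_dimensional (defect_space dot T1))
    (T2_defect : finite_dimensional (defect_space dot T2)) :
  (exists V : set (R[i]^o * R[i]^o),
     variety V /\
     forall p : {poly {poly R[i]}}, opnorm (poly_op p T1 T2) <= norm_on p V) /\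
  (is_pure dot T2 ->
   exists V : set (R[i]^o * R[i]^o),
     distinguished_variety V /\
     forall p : {poly {poly R[i]}}, opnorm (poly_op p T1 T2) <= norm_on p V).
Proof.
have [m [s [g [U [colU nondeg2 nondeg1]]]]] :=
  minimal_colligation_exists dotE T1_contr T2_contr T12_comm T1_defect T2_defect.
have [unitU _ _] := colU.
have vN p (V : set (R[i]^o * R[i]^o)) :
    (forall z lambda, `|z| = 1 -> `|lambda| = 1 -> pencil_det s U z lambda = 0 ->
      `|p.[z%:P].[lambda]| <= (norm_on p V)%:C%C) ->
  opnorm (poly_op p T1 T2) <= norm_on p V.
  move=> pV; apply: opnorm_le; first exact: norm_on_ge0.
  apply: (poly_op_norm_le dotE T1_contr T2_contr T12_comm colU nondeg2 _ pV T1_pure).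
  by rewrite ler0c norm_on_ge0.
split=> [|/nondeg1 {}nondeg1].
  exists (pencil_variety s U); split=> [|p]; last exact/vN/pencil_variety_bound.
  by exists (pencil_poly s U); split; first exact: pencil_poly_neq0.
have [/existsP[k sk]|/existsPn s0] := boolP [exists k, s k].
  exists (open_pencil_variety s U); split=> [|p].
    exact: open_pencil_variety_distinguished sk.
  exact/vN/open_pencil_variety_bound.
have [V Vd] := distinguished_variety_exists R; exists V; split=> // p.
apply: vN => z lambda z1 l1 zl.
have [c c0 cE] := pencil_det_transfer unitU nondeg2 z1 zl.
(* Without coordinates in the first class the transfer function is 0, so there is
   no zero on the torus: the space is trivial and any distinguished variety will do. *)
have E10 : proj s = 0 :> 'M[R[i]]_m.
  by apply/matrixP => i j; rewrite !mxE (negbTE (s0 i)) andbF.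
move: cE; rewrite -transfer_proj E10 !mulmx0 => /esym/eqP.
by rewrite scaler_eq0 (negbTE c0) orbF -normr_eq0 l1 oner_eq0.
Qed.
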